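(* Let $\Delta$ be a unit interval pure $(m-1)$-dimensional simplicial complex on $[n]$. The polynomials of the set $\{x_{ij}\}\cup\{[\mathbf a]\cdot t:\mathbf a\text{ is a facet of }\Delta\}$ form a SAGBI basis of the Rees algebra $\mathcal R(J_\Delta)$ with respect to the monomial order $>'$ on $R[t]$. In particular, $$\mathrm{in}_{>'}(\mathcal R(J_\Delta))=\mathbb K[X][\mathrm{in}_>(J_\Delta)\cdot t]=\mathcal R(\mathrm{in}_>(J_\Delta)).$$ Additionally, the polynomials of the set $\{[\mathbf a]:\mathbf a\text{ is a facet of }\Delta\}$ form a SAGBI basis of the $\mathbb K$-algebra $\mathbb K[J_\Delta]$ with respect to the lexicographic monomial order $>$; in particular, $\mathrm{in}_>(\mathbb K[J_\Delta])=\mathbb K[\mathrm{in}_>(J_\Delta)]$.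
   Context: Let $\mathbb K$ be a field, $m\le n$ positive integers, $X=(x_{ij})$ an $m\times n$ matrix of indeterminates and $R=\mathbb K[X]$. Let $\Delta$ be a pure $(m-1)$-dimensional simplicial complex on $[n]=\{1,\dots,n\}$; its $(m-1)$-dimensional faces (facets) are identified with $m$-subsets $\mathbf a=\{a_1<\dots<a_m\}$. A clique of $\Delta$ is an induced subcomplex any $m$ vertices of which lie together in a face; write $\Delta=\Delta_1\cup\dots\cup\Delta_r$ for the decomposition into maximal cliques (each with at least $m$ vertices). $\Delta$ is unit interval if the vertex set of each $\Delta_i$ is an interval $[u_i,v_i]=\{u_i,u_i+1,\dots,v_i\}$ with $u_i<v_i$, indexed so that $1=u_1<u_2<\dots<u_r$ and $v_r=n$. Thus an $m$-subset is a facet of $\Delta$ iff it is contained in some $[u_i,v_i]$. $[\mathbf a]$ is the maximal minor of $X$ on columns $\mathbf a$, and $J_\Delta=([\mathbf a]:\mathbf a\text{ a facet of }\Delta)\subseteq R$. Let $>$ be the lexicographic order on $R$ with $x_{11}>x_{12}>\dots>x_{1n}>x_{21}>\dots>x_{mn}$, so $\mathrm{in}_>[\mathbf a]=\mathbf x_{\mathbf a}=x_{1a_1}\cdots x_{ma_m}$. The minors $[\mathbf a]$ ($\mathbf a$ a facet) form a Gröbner basis of $J_\Delta$ (known), so $\mathrm{in}_>(J_\Delta)=(\mathbf x_{\mathbf a}:\mathbf a\text{ a facet})$. The order $>'$ on $R[t]$: for monomials $m_1,m_2$ of $R$, $m_1t^i>'m_2t^j$ if $i>j$, or $i=j$ and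 $m_1>m_2$. For an ideal $I$ of $R$, $\mathcal R(I)=R[It]\subseteq R[t]$. $\mathbb K[J_\Delta]$ denotes the $\mathbb K$-subalgebra of $R$ generated by the minors $[\mathbf a]$, $\mathbf a$ a facet of $\Delta$, and $\mathbb K[\mathrm{in}_>(J_\Delta)]$ the one generated by the monomials $\mathbf x_{\mathbf a}$, $\mathbf a$ a facet of $\Delta$. For a finitely generated $\mathbb K$-subalgebra $A$ of a polynomial ring and a term order $\tau$, the initial algebra $\mathrm{in}_\tau(A)$ is the $\mathbb K$-subalgebra generated by all initial monomials $\mathrm{in}_\tau(a)$, $0\neq a\in A$. A subset $\mathcal A\subseteq A$ is a SAGBI basis of $A$ if $\mathrm{in}_\tau(A)=\mathbb K[\mathrm{in}_\tau(f):f\in\mathcal A]$. *)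

(* Defs.v *)
From HB Require Import structures.
From mathcomp Require Import all_boot all_order all_algebra.
From mathcomp.multinomials Require Import mpoly.

Set Implicit Arguments.
Unset Strict Implicit.
Unset Printing Implicit Defensive.

Import GRing.Theory.
Local Open Scope ring_scope.

Section MonomialOrders.

Variable k : nat.

Record monomial_order := MonomialOrder {
  mo_lt :> rel 'X_{1..k};
  mo_irr : irreflexive mo_lt;
  mo_trans : transitive mo_lt;
  mo_total : forall u v, [|| mo_lt u v, u == v | mo_lt v u];
  mo_gt0 : forall u, u != 0%MM -> mo_lt 0%MM u;
  mo_add : forall u v w, mo_lt u v -> mo_lt (u + w)%MM (v + w)%MM
}.

(* Lexicographic order with 'X_0 > 'X_1 > ... > 'X_(k-1); unlike the default
   order of 'X_{1..k} in the library, it does not compare degrees first. *)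
Definition lex_lt : rel 'X_{1..k} := fun u v =>
  [exists i : 'I_k,
     (u i < v i)%N && [forall j : 'I_k, (j < i)%N ==> (u j == v j)]].

Lemma lex_ltP (u v : 'X_{1..k}) :
  reflect (exists2 i : 'I_k, (u i < v i)%N &
             forall j : 'I_k, (j < i)%N -> u j = v j)
          (lex_lt u v).
Proof.
apply: (iffP existsP) => [[i /andP[lt_i /forallP eq_j]] | [i lt_i eq_j]].
  by exists i => // j lt_ji; apply/eqP; apply: (implyP (eq_j j)).
by exists i; rewrite lt_i; apply/forallP=> j; apply/implyP=> /eq_j->.
Qed.

Lemma lex_irr : irreflexive lex_lt.
Proof. by move=> u; apply/lex_ltP => -[i]; rewrite ltnn. Qed.

Lemma lex_trans : transitive lex_lt.
Proof.
move=> v u w /lex_ltP[i lt_i eq_i] /lex_ltP[j lt_j eq_j]; apply/lex_ltP.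
case: (ltngtP i j) => [ij | ji | /val_inj ij].
- exists i; first by rewrite -(eq_j i ij).
  by move=> l li; rewrite (eq_i l li) (eq_j l (ltn_trans li ij)).
- exists j; first by rewrite (eq_i j ji).
  by move=> l lj; rewrite -(eq_j l lj) (eq_i l (ltn_trans lj ji)).
- subst j; exists i; first exact: ltn_trans lt_j.
  by move=> l li; rewrite (eq_i l li) (eq_j l li).
Qed.

Lemma lex_total u v : [|| lex_lt u v, u == v | lex_lt v u].
Proof.
case: (pickP (fun i : 'I_k => u i != v i)) => [i0 ne0 | eq_uv]; last first.
  have /eqP-> : u == v; last by rewrite eqxx orbT.
  by apply/eqP/mnmP=> i; apply/eqP/negbFE/eq_uv.
case: (@arg_minnP _ i0 (fun i => u i != v i) (fun i : 'I_k => i : nat) ne0) => i ne_i min_i.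
have eq_j (j : 'I_k) : (j < i)%N -> u j = v j.
  by move=> lt_ji; apply: contraTeq lt_ji => /min_i; rewrite -leqNgt.
case: (ltngtP (u i) (v i)) => [lt_uv | lt_vu | /eqP]; last by rewrite (negPf ne_i).
- by apply/or3P/Or31/lex_ltP; exists i.
- by apply/or3P/Or33/lex_ltP; exists i => // j /eq_j.
Qed.

Lemma lex_gt0 u : u != 0%MM -> lex_lt 0%MM u.
Proof.
move=> nz_u; case/or3P: (lex_total 0%MM u) => // [/eqP u0 | /lex_ltP[i]].
  by rewrite -u0 eqxx in nz_u.
by rewrite mnm0E.
Qed.

Lemma lex_add u v w : lex_lt u v -> lex_lt (u + w)%MM (v + w)%MM.
Proof.
case/lex_ltP=> i lt_i eq_j; apply/lex_ltP; exists i.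
  by rewrite !mnmDE ltn_add2r.
by move=> j lt_ji; rewrite !mnmDE eq_j.
Qed.

Definition lex_order : monomial_order :=
  MonomialOrder lex_irr lex_trans lex_total lex_gt0 lex_add.

End MonomialOrders.

(* R[t] is modelled as {mpoly K[k.+1]} for R = {mpoly K[k]}: R embeds through
   mwiden and t is the last variable. *)
Section ReesOrder.

Variable k : nat.

Definition xpart (u : 'X_{1..k.+1}) : 'X_{1..k} :=
  [multinom u (widen_ord (leqnSn k) i) | i < k].

Definition t_lex_lt : rel 'X_{1..k.+1} := fun u v =>
  (u ord_max < v ord_max)%N ||
  (u ord_max == v ord_max) && lex_lt (xpart u) (xpart v).

Lemma xpart_inj (u v : 'X_{1..k.+1}) : u ord_max = v ord_max -> xpart u = xpart v -> u = v.
Proof.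
move=> eq_t eq_x; apply/mnmP=> i; case: (unliftP ord_max i) => [j ->|-> //].
have /mnmP/(_ j) := eq_x; rewrite !mnmE.
by have -> : widen_ord (leqnSn k) j = lift ord_max j
  by apply/val_inj; rewrite /= /bump leqNgt ltn_ord.
Qed.

Lemma xpartD (u v : 'X_{1..k.+1}) : xpart (u + v)%MM = (xpart u + xpart v)%MM.
Proof. by apply/mnmP=> i; rewrite !(mnmE, mnmDE). Qed.

Lemma t_lex_irr : irreflexive t_lex_lt.
Proof. by move=> u; rewrite /t_lex_lt ltnn eqxx lex_irr. Qed.

Lemma t_lex_trans : transitive t_lex_lt.
Proof.
move=> v u w; rewrite /t_lex_lt.
case/orP=> [lt_uv | /andP[/eqP-> lt_uv]] /orP[lt_vw | /andP[/eqP<- lt_vw]].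
- by rewrite (ltn_trans lt_uv lt_vw).
- by rewrite lt_uv.
- by rewrite lt_vw.
- by rewrite eqxx (lex_trans lt_uv lt_vw) orbT.
Qed.

Lemma t_lex_total u v : [|| t_lex_lt u v, u == v | t_lex_lt v u].
Proof.
rewrite /t_lex_lt; case: (ltngtP (u ord_max) (v ord_max)) => //= [|eq_t].
  by rewrite !orbT.
case/or3P: (lex_total (xpart u) (xpart v)) => [-> // | /eqP eq_x | ->].
  by rewrite (xpart_inj eq_t eq_x) eqxx orbT.
by rewrite !orbT.
Qed.

Lemma t_lex_gt0 u : u != 0%MM -> t_lex_lt 0%MM u.
Proof.
move=> nz_u; case/or3P: (t_lex_total 0%MM u) => // [/eqP u0 | ].
  by rewrite -u0 eqxx in nz_u.
rewrite /t_lex_lt mnm0E /= => /andP[_ /lex_ltP[i]].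
by rewrite [X in (_ < X)%N]mnmE mnm0E.
Qed.

Lemma t_lex_add u v w : t_lex_lt u v -> t_lex_lt (u + w)%MM (v + w)%MM.
Proof.
rewrite /t_lex_lt !mnmDE !xpartD ltn_add2r eqn_add2r.
by case/orP=> [-> // | /andP[-> /lex_add->]]; rewrite orbT.
Qed.

Definition t_lex_order : monomial_order k.+1 :=
  MonomialOrder t_lex_irr t_lex_trans t_lex_total t_lex_gt0 t_lex_add.

End ReesOrder.

Section InitialAlgebras.

Variables (K : fieldType) (k : nat).
Local Notation P := {mpoly K[k]}.
Implicit Types (S A I : P -> Prop) (tau : monomial_order k).

Definition eq_set S1 S2 := forall p, S1 p <-> S2 p.

Inductive ideal_gen S : P -> Prop :=
| ideal_gen_mem p : S p -> ideal_gen S p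
| ideal_gen0 : ideal_gen S 0
| ideal_genD p q : ideal_gen S p -> ideal_gen S q -> ideal_gen S (p + q)
| ideal_genM p q : ideal_gen S q -> ideal_gen S (p * q).

Inductive alg_gen S : P -> Prop :=
| alg_gen_mem p : S p -> alg_gen S p
| alg_genC c : alg_gen S c%:MP
| alg_genD p q : alg_gen S p -> alg_gen S q -> alg_gen S (p + q)
| alg_genM p q : alg_gen S p -> alg_gen S q -> alg_gen S (p * q).

(* The zero polynomial has empty support, hence no initial monomial. *)
Definition is_initial tau (p : P) (u : 'X_{1..k}) : Prop :=
  u \in msupp p /\ forall v, v \in msupp p -> v != u -> tau v u.

Definition initial_monomials tau S : P -> Prop := fun q =>
  exists p u, [/\ S p, is_initial tau p u & q = 'X_[u]].

Definition initial_ideal tau I := ideal_gen (initial_monomials tau I).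

Definition initial_algebra tau A := alg_gen (initial_monomials tau A).

Definition sagbi_basis tau A S :=
  (forall p, S p -> A p) /\
  eq_set (initial_algebra tau A) (alg_gen (initial_monomials tau S)).

End InitialAlgebras.

(* R[S t], the R-subalgebra of R[t] generated by the f * t with f in S *)
Definition adjoin_t (K : fieldType) (k : nat) (S : {mpoly K[k]} -> Prop) :
    {mpoly K[k.+1]} -> Prop :=
  alg_gen (fun q => (exists f, q = mwiden f) \/
                    (exists2 f, S f & q = mwiden f * 'X_ord_max)).

Definition rees (K : fieldType) (k : nat) (I : {mpoly K[k]} -> Prop) :=
  adjoin_t I.

Section Complexes.

(* The vertex i of [n] is the element of 'I_n with value i - 1. *)
Variables (m n : nat).
Implicit Types (D : {set {set 'I_n}}) (F W : {set 'I_n}).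

Definition is_complex D : Prop :=
  set0 \in D /\ forall F G : {set 'I_n}, F \in D -> G \subset F -> G \in D.

Definition facets D : {set {set 'I_n}} :=
  [set F | maxset (fun G : {set 'I_n} => G \in D) F].

(* pure of dimension m - 1 *)
Definition pure_complex D : Prop :=
  is_complex D /\ forall F, F \in facets D -> #|F| = m.

Definition induced D W : {set {set 'I_n}} := [set F in D | F \subset W].

(* The bound m <= #|W| excludes the sets with fewer than m vertices, for which
   the second condition is void. *)
Definition is_clique D W : bool :=
  (m <= #|W|)%N &&
  [forall F : {set 'I_n}, (F \subset W) && (#|F| == m) ==>
     [exists G in induced D W, F \subset G]].

Definition maximal_clique D W : bool := maxset (is_clique D) W.

Definition interval (u v : 'I_n) : {set 'I_n} :=
  [set i : 'I_n | (u <= i <= v)%N].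

Definition unit_interval D : Prop :=
  exists (r : nat) (u v : 'I_r.+1 -> 'I_n),
  [/\ forall W, maximal_clique D W <-> exists i, W = interval (u i) (v i),
      forall i, (u i < v i)%N,
      forall i j : 'I_r.+1, (i < j)%N -> (u i < u j)%N,
      u ord0 = 0%N :> nat
    & (v ord_max).+1 = n].

(* An m-subset a_1 < ... < a_m is given by its increasing enumeration. *)
Definition is_facet D (a : 'I_m -> 'I_n) : Prop :=
  (forall i j : 'I_m, (i < j)%N -> (a i < a j)%N) /\
  [set a i | i : 'I_m] \in facets D.

End Complexes.

(* mxvec_index enumerates the entries row by row, so that lex_order compares
   x_11 > x_12 > ... > x_1n > x_21 > ... > x_mn. *)
Lemma mxvec_index_val (m n : nat) (i : 'I_m) (j : 'I_n) :
  mxvec_index i j = (i * n + j)%N :> nat.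
Proof.
rewrite /= /enum_rank enum_rank_in.unlock insubdK; last first.
  by rewrite unfold_in /= cardE index_mem mem_enum.
have -> : enum {: 'I_m * 'I_n} = prod_enum 'I_m 'I_n by rewrite enumT unlock.
rewrite /prod_enum; transitivity (index i (enum 'I_m) * n + j)%N; last first.
  by rewrite index_enum_ord.
elim: (enum 'I_m) (mem_enum 'I_m i) => [//|i1 s IHs] /= i_s.
rewrite index_cat size_map size_enum_ord; case: eqVneq => [->|ne_i].
  have inj2 : injective (pair i : 'I_n -> 'I_m * 'I_n) by move=> ? ? [].
  by rewrite mem_map // mem_enum index_map // index_enum_ord.
rewrite ifN; last by apply/mapP=> -[j1 _ [e _]]; rewrite e eqxx in ne_i.
rewrite IHs ?mulSn ?addnA //.
by move: i_s; rewrite !inE eq_sym (negPf ne_i).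
Qed.

Section DeterminantalFacetIdeal.

Variables (K : fieldType) (m n : nat).
Implicit Types (D : {set {set 'I_n}}) (a : 'I_m -> 'I_n).
Local Notation R := {mpoly K[m * n]}.

Definition gmx : 'M[R]_(m, n) := \matrix_(i, j) 'X_(mxvec_index i j).

Definition maxminor a : R := \det (colsub a gmx).

Definition diag_mon a : R := \prod_(i < m) gmx i (a i).

Definition facet_minors D : R -> Prop :=
  fun p => exists2 a, is_facet D a & p = maxminor a.

Definition facet_mons D : R -> Prop :=
  fun p => exists2 a, is_facet D a & p = diag_mon a.

Definition J D : R -> Prop := ideal_gen (facet_minors D).

Definition rees_gens D : {mpoly K[(m * n).+1]} -> Prop := fun q =>
  (exists i j, q = mwiden (gmx i j)) \/
  (exists2 a, is_facet D a & q = mwiden (maxminor a) * 'X_ord_max).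

End DeterminantalFacetIdeal.

Arguments J K m {n} D.
Arguments facet_minors K m {n} D.
Arguments facet_mons K m {n} D.
Arguments rees_gens K m {n} D.

(* Main.v *)
Require Import Defs.
From mathcomp Require Import all_boot all_order all_algebra all_fingroup.
From mathcomp Require Import ring zify.
From mathcomp.multinomials Require Import mpoly.

Set Implicit Arguments.
Unset Strict Implicit.
Unset Printing Implicit Defensive.

Import GRing.Theory.

(** Call product any x^alpha [a_1] ... [a_s] t^s with facets a_1, ..., a_s.  The products
    span the Rees algebra linearly, and each has leading coefficient 1 and initial
    monomial x^alpha x_(a_1) ... x_(a_s) t^s, a monomial in the proposed generators of
    the initial algebra.  So it is enough that no cancellation creates new initial
    monomials, and by [subduction] this follows from the lifting condition
    [rees_prod_cong]: two products with the same initial monomial u are congruent,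
    that is, they differ by a linear combination of products with initial monomials
    smaller than u.

    Two elementary congruences generate all the others.
    - Sorting, [straighten_facets]: [a][b] is congruent to [c][d], where c and d are the
      entrywise minimum and maximum of a and b.  The Garnir relations write [a][b]
      as a combination of products [c][d] with c <= d entrywise; such products have
      distinct initial monomials, so the one with the initial monomial of [a][b]
      occurs with coefficient 1 and the others are smaller ([straighten_leads]).
    - Replacing, [replace_cong]: if e <= c are facets and x^alpha x_c = x^beta x_e then
      x^alpha [c] is congruent to x^beta [e].  If c and e have an entry in common,
      one changes one entry at a time through facets by Cramer's rule
      ([cramer_exchange]); if they have none, the congruence comes from the relation
      [e][c] = [c][e].

    Given two products with the same initial monomial, sorting makes their first facets
    c and d smaller than all the following ones.  The entries of the meet e of c and d
    occur in the common initial monomial, and those that are not entries of c can in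
    the first product only come from the variables; so c can be replaced by e, likewise
    d in the second product, and after cancelling [e] one concludes by induction on s.

    The unit interval hypothesis enters because the maximal cliques are intervals whose
    lower and upper ends are ordered alike ([clique_interval_chain]): this keeps the
    facets produced by sorting, by the meet and by replacing inside the complex.

    For the algebra of the minors alone, the total degree excludes variables from the
    congruences ([facet_prod_cong]), and the same criterion applies. *)
Local Open Scope ring_scope.

(** * Well-foundedness of the two monomial orders *)

Section WellFounded.

(** The orders compare one exponent first and then the remaining ones, so they are
    well-founded as lexicographic products, even where u has infinitely many
    predecessors. *)
Lemma wf_lex_pair (T S : Type) (R : T -> T -> Prop) (RS : S -> S -> Prop)
    (f : T -> nat) (g : T -> S) :
    (forall x y, R x y -> (f x < f y)%N \/ f x = f y /\ RS (g x) (g y)) ->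
  well_founded RS -> well_founded R.
Proof.
move=> R_fg wfS.
suff accR a s : forall x, f x = a -> g x = s -> Acc R x by move=> x; apply: accR.
elim/ltn_ind: a s => a IHa; apply: (well_founded_ind wfS) => s IHs x fx gx.
constructor=> y /R_fg[lt_yx | [eq_yx lt_yx]].
  by apply: (IHa (f y) _ (g y)); rewrite // -fx.
by apply: (IHs (g y)); rewrite -?gx // eq_yx.
Qed.

Lemma lex_wf k : well_founded (fun u v : 'X_{1..k} => lex_lt u v).
Proof.
elim: k => [|k IHk]; first by move=> u; constructor=> v /lex_ltP[[]].
pose tl (u : 'X_{1..k.+1}) := [multinom u (lift ord0 i) | i < k].
apply: (@wf_lex_pair _ _ _ _ (fun u : 'X_{1..k.+1} => u ord0) tl _ IHk) => u v.
case/lex_ltP=> i; case: (unliftP ord0 i) => [j|] -> lt_uv eq_uv; last by left.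
right; split; first exact: eq_uv.
apply/lex_ltP; exists j; first by rewrite !mnmE.
by move=> l lt_lj; rewrite !mnmE; apply: eq_uv.
Qed.

Lemma t_lex_wf k : well_founded (fun u v : 'X_{1..k.+1} => t_lex_lt u v).
Proof.
apply: (@wf_lex_pair _ _ _ _ (fun u : 'X_{1..k.+1} => u ord_max) (@xpart k) _ (@lex_wf k)).
by move=> u v /orP[|/andP[/eqP-> ->]]; [left | right].
Qed.

End WellFounded.

(** * Linear spans, leading monomials and subduction *)

Section Span.

Variables (K : fieldType) (k : nat).
Local Notation P := {mpoly K[k]}.
Implicit Types (S : P -> Prop) (p q f : P) (u v w : 'X_{1..k}).

(** K-linear combinations of elements of S, built one term at a time so that the
    proofs below go by induction on the number of terms. *)
Inductive lspan S : P -> Prop :=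
| lspan0 : lspan S 0
| lspanDZ c p q : S p -> lspan S q -> lspan S (c *: p + q).

Lemma lspan_mem S p : S p -> lspan S p.
Proof. by move=> Sp; rewrite -[p]scale1r -[_ *: p]addr0; constructor=> //; constructor. Qed.

Lemma lspanD S p q : lspan S p -> lspan S q -> lspan S (p + q).
Proof.
move=> Sp Sq; elim: Sp => [|c r s Sr _ IHs]; first by rewrite add0r.
by rewrite -addrA; constructor.
Qed.

Lemma lspanZ S c p : lspan S p -> lspan S (c *: p).
Proof.
elim=> [|b r s Sr _ IHs]; first by rewrite scaler0; constructor.
by rewrite scalerDr scalerA; constructor.
Qed.

Lemma lspanN S p : lspan S p -> lspan S (- p).
Proof. by rewrite -scaleN1r; apply: lspanZ. Qed.

Lemma lspanB S p q : lspan S p -> lspan S q -> lspan S (p - q).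
Proof. by move=> Sp Sq; apply: lspanD => //; apply: lspanN. Qed.

Lemma lspan_sum (I : Type) (r : seq I) (B : pred I) (F : I -> P) S :
  (forall i, B i -> lspan S (F i)) -> lspan S (\sum_(i <- r | B i) F i).
Proof. by move=> SF; apply: big_ind => //; [constructor | apply: lspanD]. Qed.

Lemma lspan_bind S S' p : (forall q, S q -> lspan S' q) -> lspan S p -> lspan S' p.
Proof.
move=> SS'; elim=> [|c r s Sr _ IHs]; first by constructor.
by apply: lspanD => //; apply/lspanZ/SS'.
Qed.

Lemma sub_lspan S S' p : (forall q, S q -> S' q) -> lspan S p -> lspan S' p.
Proof. by move=> SS'; apply: lspan_bind => q Sq; apply/lspan_mem/SS'. Qed.

Lemma lspan_mulr S S' r p : (forall q, S q -> lspan S' (q * r)) -> lspan S p -> lspan S' (p * r).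
Proof.
move=> SS'; elim=> [|c q s Sq _ IHs]; first by rewrite mul0r; constructor.
by rewrite mulrDl -scalerAl; apply: lspanD => //; apply/lspanZ/SS'.
Qed.

Lemma lspan_monomials f : lspan (fun q => exists u, q = 'X_[u]) f.
Proof.
rewrite [f]mpolyE; apply: lspan_sum => u _.
by apply/lspanZ/lspan_mem; exists u.
Qed.

End Span.

Lemma lspan_map (K : fieldType) (k l : nat) (h : {mpoly K[k]} -> {mpoly K[l]})
    (S : {mpoly K[k]} -> Prop) (S' : {mpoly K[l]} -> Prop) p :
    h 0 = 0 -> {morph h : q r / q + r} -> (forall c, {morph h : q / c *: q}) ->
  (forall q, S q -> lspan S' (h q)) -> lspan S p -> lspan S' (h p).
Proof.
move=> h0 hD hZ SS'; elim=> [|c q s Sq _ IHs]; first by rewrite h0; constructor.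
by rewrite hD hZ; apply: lspanD => //; apply/lspanZ/SS'.
Qed.

Section Leading.

Variables (K : fieldType) (k : nat) (tau : monomial_order k).
Local Notation P := {mpoly K[k]}.
Implicit Types (S : P -> Prop) (p q f : P) (u v w : 'X_{1..k}).

(** The initial monomial together with a normalised coefficient: every product of
    variables and minors has leading coefficient 1, so differences of two products
    with the same initial monomial lose that monomial. *)
Definition leads p u := p@_u = 1 /\ forall v, p@_v != 0 -> v != u -> tau v u.

Lemma mo_asym u v : tau u v -> tau v u -> False.
Proof. by move=> uv vu; have:= mo_trans uv vu; rewrite mo_irr. Qed.

Lemma leads_initial p u : leads p u -> is_initial tau p u.
Proof.
case=> pu1 lt_u; split; first by rewrite mcoeff_msupp pu1 oner_eq0.
by move=> v; rewrite mcoeff_msupp; apply: lt_u.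
Qed.

Lemma initial_uniq p u v : is_initial tau p u -> is_initial tau p v -> u = v.
Proof.
case=> p_u lt_u [p_v lt_v]; apply/eqP/idPn=> ne_uv.
by apply: (@mo_asym u v); [apply: lt_v | apply: lt_u => //; rewrite eq_sym].
Qed.

Lemma leadsX u : leads 'X_[u] u.
Proof.
split=> [|v]; first by rewrite mcoeffX eqxx.
by rewrite mcoeffX; have [//|_] := eqVneq u v; rewrite /= eqxx.
Qed.

Lemma mo_addl u v w : tau u v -> tau (w + u)%MM (w + v)%MM.
Proof. by rewrite ![(w + _)%MM]addmC; apply: mo_add. Qed.

Definition mo_le u v := u = v \/ tau u v.

Lemma mo_le_lt_trans v u w : mo_le u v -> tau v w -> tau u w.
Proof. by case=> [->|/mo_trans]; last exact. Qed.

Lemma mo_le_total u v : mo_le u v \/ tau v u.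
Proof. by case/or3P: (mo_total tau u v) => [|/eqP|]; rewrite /mo_le; auto. Qed.

Lemma leads_le p u v : leads p u -> p@_v != 0 -> mo_le v u.
Proof. by case=> _ lt_u nz; have [->|ne] := eqVneq v u; [left | right; apply: lt_u]. Qed.

Lemma leadsM p q u v : leads p u -> leads q v -> leads (p * q) (u + v)%MM.
Proof.
move=> pu qv.
have le_mul w1 w2 : p@_w1 != 0 -> q@_w2 != 0 ->
    w1 = u /\ w2 = v \/ tau (w1 + w2)%MM (u + v)%MM.
  move=> /(leads_le pu)[->|lt1] /(leads_le qv)[->|lt2]; first by left.
  - by right; apply: mo_addl.
  - by right; apply: mo_add.
  by right; apply: mo_trans (mo_addl _ lt2); apply: mo_add.
have pqE w : w \in msupp (p * q) -> exists w1 w2,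
    [/\ p@_w1 != 0, q@_w2 != 0 & w = (w1 + w2)%MM].
  case/msuppM_le/allpairsP=> -[w1 w2] /= [].
  by rewrite !mcoeff_msupp => p1 q2 ->; exists w1, w2.
split; last first.
  move=> w; rewrite -mcoeff_msupp => /pqE[w1 [w2 [p1 q2 ->]]] ne.
  by case: (le_mul _ _ p1 q2) ne => [[-> ->]|//]; rewrite eqxx.
have [p1 _] := pu; have [q1 _] := qv.
have lt_sub w : p@_w != 0 -> w = u \/ tau w u by apply: leads_le.
rewrite [p]mpolyE mulr_suml raddf_sum /= (bigD1_seq u) ?msupp_uniq //=; last first.
  by rewrite mcoeff_msupp p1 oner_eq0.
rewrite big_seq_cond big1 ?addr0 => [|w /andP[]]; last first.
  rewrite mcoeff_msupp => pw ne_wu; rewrite -scalerAl mcoeffZ.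
  have {ne_wu}lt_wu: tau w u by case: (lt_sub _ pw) ne_wu => [->|//]; rewrite eqxx.
  apply/eqP; rewrite mulf_eq0; apply/orP; right; apply: contraT.
  rewrite mulrC -mcoeff_msupp => /msuppM_le/allpairsP[[w1 w2] /=].
  rewrite msuppX inE mcoeff_msupp => -[q1' /eqP-> e].
  have /(leads_le qv)[e1|lt1] := q1'.
    by move: e; rewrite e1 addmC => /addmI e; rewrite e mo_irr in lt_wu.
  have := mo_trans (mo_add w lt1) (mo_addl v lt_wu).
  by rewrite -e addmC mo_irr.
by rewrite p1 scale1r mulrC mcoeffMX q1.
Qed.

End Leading.

Section Subduction.

Variables (K : fieldType) (k : nat) (tau : monomial_order k).
Hypothesis tau_wf : well_founded (fun u v => tau u v).
Local Notation P := {mpoly K[k]}.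
Variable Q : P -> 'X_{1..k} -> Prop.
Hypothesis Q_leads : forall p u, Q p u -> leads tau p u.

Definition below u : P -> Prop := fun p => exists2 v, Q p v & tau v u.

(** The lifting condition of the SAGBI criterion: a binomial relation between
    initial monomials lifts to a relation modulo products with a smaller initial
    monomial. *)
Hypothesis Q_cong : forall p q u, Q p u -> Q q u -> lspan (below u) (p - q).

Let upto u : P -> Prop := fun p => exists2 v, Q p v & mo_le tau v u.

Lemma below_coeff u p : lspan (below u) p -> forall v, p@_v != 0 -> tau v u.
Proof.
elim=> [|c q r [w Qq lt_wu] _ IHr] v; first by rewrite mcoeff0 eqxx.
rewrite mcoeffD mcoeffZ; have [-> | r_v _] := eqVneq r@_v 0; last exact: IHr.
rewrite addr0 mulf_eq0 negb_or => /andP[_ q_v].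
exact: mo_le_lt_trans (leads_le (Q_leads Qq) q_v) lt_wu.
Qed.

Lemma lspan_bounded (B : 'X_{1..k} -> Prop) p :
    lspan (fun q => exists2 u, Q q u & B u) p ->
  p = 0 \/ exists2 u, B u & lspan (upto u) p.
Proof.
elim=> [|c q r [u Qq Bu] _ [-> | [v Bv r_v]]]; first by left.
  by right; exists u => //; rewrite addr0; apply/lspanZ/lspan_mem; exists u; last left.
right; case: (mo_le_total tau u v) => [le_uv | lt_vu].
  exists v => //; apply: lspanD => //; apply/lspanZ/lspan_mem.
  by exists u.
exists u => //; apply: lspanD; first by apply/lspanZ/lspan_mem; exists u; last left.
apply: sub_lspan r_v => s [w Qs le_wv]; exists w => //; right.
exact: mo_le_lt_trans le_wv lt_vu.
Qed.

(** Under the lifting condition all products with initial monomial u agree modulo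
    smaller ones, so those occurring in f can be merged into a single one. *)
Lemma lspan_upto u f : lspan (upto u) f ->
  lspan (below u) f \/ exists p c, Q p u /\ lspan (below u) (f - c *: p).
Proof.
elim=> [|c q r [v Qq le_vu] _ IHr]; first by left; constructor.
case: le_vu => [e | lt_vu]; last first.
  have q_b: lspan (below u) (c *: q) by apply/lspanZ/lspan_mem; exists v.
  case: IHr => [r_b | [p [b [Qp r_b]]]]; first by left; apply: lspanD.
  by right; exists p, b; split=> //; rewrite -addrA; apply: lspanD.
rewrite {v}e in Qq; right; case: IHr => [r_b | [p [b [Qp r_b]]]].
  by exists q, c; split=> //; rewrite addrC addKr in r_b *.
exists q, (c + b); split=> //.
have -> : c *: q + r - (c + b) *: q = (r - b *: p) + b *: (p - q).
  rewrite scalerDl scalerBr opprD addrACA addrA subrr add0r [RHS]addrA.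
  by congr (_ - _); rewrite subrK.
by apply: lspanD => //; apply/lspanZ/Q_cong.
Qed.

(** Every initial monomial of the span of Q is that of a member of Q.  Write f with
    all its terms of initial monomial at most w, and merge the terms of initial
    monomial w into one; if its coefficient is not zero then w is the initial
    monomial of f, and otherwise w can be lowered.  This stops because the order is
    well-founded. *)
Lemma subduction f u : lspan (fun p => exists v, Q p v) f ->
    is_initial tau f u ->
  exists2 p, Q p u & lspan (below u) (f - f@_u *: p).
Proof.
move=> Qf f_u; have nz_f: f != 0.
  by case: f_u => f_u _; apply: contraTneq f_u => ->; rewrite -mpolyC0 msupp0.
have [|/eqP f0 | [w _]] := @lspan_bounded (fun _ => True) f.
- by apply: sub_lspan Qf => p [v]; exists v.
- by rewrite f0 in nz_f.
move: w {Qf}; apply: (well_founded_ind tau_wf) => w IHw f_w.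
have low : lspan (below w) f -> exists2 p, Q p u & lspan (below u) (f - f@_u *: p).
  by case/lspan_bounded=> [/eqP f0 | [v /IHw]]; [rewrite f0 in nz_f | apply].
have [// | [p [c [Qp f_b]]]] := lspan_upto f_w.
have [c0 | nz_c] := eqVneq c 0; first by rewrite c0 scale0r subr0 in f_b; apply: low.
have [p_w lt_p] := Q_leads Qp.
have fE v : f@_v = c * p@_v + (f - c *: p)@_v by rewrite mcoeffB mcoeffZ addrC subrK.
have f_bw : (f - c *: p)@_w = 0.
  by apply/eqP; apply: contraT => /(below_coeff f_b); rewrite mo_irr.
have f_w1 : f@_w = c by rewrite fE f_bw p_w mulr1 addr0.
have -> : u = w.
  apply: initial_uniq f_u _; split; first by rewrite mcoeff_msupp f_w1.
  move=> v; rewrite mcoeff_msupp fE => nz_v ne_vw.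
  have [e | /(below_coeff f_b)//] := eqVneq (f - c *: p)@_v 0.
  by apply: lt_p => //; apply: contraNneq nz_v => ->; rewrite e mulr0 addr0.
by exists p; rewrite ?f_w1.
Qed.

End Subduction.

(** * The Garnir relation between maximal minors *)

Lemma prod_eq0 (R : comNzRingType) (I : finType) (F : I -> R) i :
  F i = 0 -> \prod_j F j = 0.
Proof. by move=> Fi0; rewrite (bigD1 i) //= Fi0 mul0r. Qed.

(** Fix i with g i < f i.  Place the columns f and g of X side by side, once in m top
    rows and once in m bottom rows (here transposed, so that columns of X become
    rows), erasing from the top the columns g b with b > i and from the bottom the
    columns f a with a < i.  Subtracting the top from the bottom leaves only m - 1
    nonzero columns in the bottom block, so the determinant vanishes.  Expanding it
    by distributing each column over the top and the bottom gives a vanishing sum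
    of products of two minors: the summand that keeps f on top and g at the bottom
    is [f][g], and every other one moves to the top some columns of g that are at
    most g i, in exchange for columns of f that are at least f i. *)

Section Garnir.

Variables (R : comNzRingType) (m n : nat) (X : 'M[R]_(m, n)).
Variables (f g : 'I_m -> 'I_n) (i : 'I_m).

Local Notation minor h := (\det (colsub h X)).
Local Notation lsh := (@lshift m m).
Local Notation rsh := (@rshift m m).

Definition joint (k : 'I_(m + m)) : 'I_n :=
  match split k with inl a => f a | inr b => g b end.

Definition is_top (k : 'I_(m + m)) : bool :=
  if split k is inl _ then true else false.

Definition top_ok (k : 'I_(m + m)) : bool :=
  match split k with inl _ => true | inr b => (b <= i)%N end.

Definition bot_ok (k : 'I_(m + m)) : bool :=
  match split k with inl a => (i <= a)%N | inr _ => true end.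

Let split_l a : split (lsh a) = inl a. Proof. exact: (unsplitK (inl a)). Qed.
Let split_r a : split (rsh a) = inr a. Proof. exact: (unsplitK (inr a)). Qed.

Let is_top_l a : is_top (lsh a). Proof. by rewrite /is_top split_l. Qed.
Let is_top_r a : is_top (rsh a) = false. Proof. by rewrite /is_top split_r. Qed.

Let Top : 'M[R]_(m + m, m) :=
  \matrix_(k, a) (if top_ok k then X a (joint k) else 0).
Let Bot : 'M[R]_(m + m, m) :=
  \matrix_(k, a) (if bot_ok k then X a (joint k) else 0).

(** A nonzero term of the Leibniz formula for Bot - Top would assign to the m
    columns of that block m distinct positions among the m - 1 surviving ones. *)
Let det_Top_Bot : \det (row_mx Top Bot) = 0.
Proof.
have <- : \det (row_mx Top (Bot - Top)) = \det (row_mx Top Bot).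
  have -> : row_mx Top (Bot - Top) =
      row_mx Top Bot *m (block_mx 1%:M (- 1%:M) 0 1%:M : 'M_(m + m)).
    by rewrite mul_row_block !mulmx1 mulmx0 addr0 mulmxN mulmx1 addrC.
  by rewrite det_mulmx det_ublock !det1 !mulr1.
apply: big1 => s _; set A := row_mx _ _.
have [k /eqP A0 | nzA] := pickP (fun k => A k (s k) == 0).
  by rewrite (prod_eq0 (i := k)) ?mulr0.
pose under k : 'I_m := match split k with inl a => a | inr b => b end.
(* The underlying index in 'I_m of the position sent by s to the column a of the
   second block: it is injective and misses i. *)
pose h a := under ((s^-1)%g (rsh a)).
have bad a : top_ok ((s^-1)%g (rsh a)) != bot_ok ((s^-1)%g (rsh a)).
  apply: contraFneq (nzA ((s^-1)%g (rsh a))) => eq_ok.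
  by rewrite permKV /A row_mxEr !mxE eq_ok subrr.
have h_inj : injective h.
  move=> a b eq_h; suff: (s^-1)%g (rsh a) = (s^-1)%g (rsh b).
    by move/perm_inj/rshift_inj.
  move: (bad a) (bad b) eq_h; rewrite /h /top_ok /bot_ok /under.
  case: split_ordP => a' -> /=; case: split_ordP => b' -> //= le_a le_b eq_ab.
  - by rewrite eq_ab.
  - by rewrite eq_ab in le_a; case: leqP le_a le_b => //; case: ltngtP.
  - by rewrite eq_ab in le_a; case: leqP le_a le_b => //; case: ltngtP.
  - by rewrite eq_ab.
have /codomP[a def_i] := injF_onto h_inj i.
move: (bad a) def_i; rewrite /h /top_ok /bot_ok /under.
by case: split_ordP => b _ => [|] + def_b; rewrite -def_b leqnn.
Qed.

(** The summand in which the column k stands on top exactly when e k holds. *)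
Definition garnir_mx (e : {ffun 'I_(m + m) -> bool}) : 'M[R]_(m + m) :=
  \matrix_(k, r) (if e k then row_mx Top 0 k r else row_mx 0 Bot k r).


Let sum_garnir : \sum_e \det (garnir_mx e) = 0.
Proof.
rewrite -[RHS]det_Top_Bot.
transitivity (\sum_(s : 'S_(m + m))
    \sum_e (-1) ^+ s * \prod_k garnir_mx e k (s k)); first by rewrite [RHS]exchange_big.
apply: eq_bigr => s _; rewrite -mulr_sumr; congr (_ * _).
pose F k b := if b then row_mx Top 0 k (s k) else row_mx 0 Bot k (s k).
transitivity (\sum_(e : {ffun 'I_(m + m) -> bool}) \prod_k F k (e k)).
  by apply: eq_bigr => e _; apply: eq_bigr => k _; rewrite mxE.
rewrite -(bigA_distr_bigA F); apply: eq_bigr => k _.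
rewrite big_bool /= /F; case: (split_ordP (s k)) => a ->.
  by rewrite !row_mxEl [const_mx _ _ _]mxE addr0.
by rewrite !row_mxEr [const_mx _ _ _]mxE add0r.
Qed.

Definition garnir0 : {ffun 'I_(m + m) -> bool} := [ffun k => is_top k].

Let det_garnir0 : \det (garnir_mx garnir0) = minor f * minor g.
Proof.
have -> : garnir_mx garnir0 = block_mx (colsub f X)^T 0 0 (colsub g X)^T.
  apply/matrixP=> k r; rewrite mxE ffunE /is_top.
  case: (split_ordP k) => a ->; case: (split_ordP r) => b ->.
  - by rewrite block_mxEul row_mxEl !mxE /top_ok /joint split_l.
  - by rewrite block_mxEur row_mxEr !mxE.
  - by rewrite block_mxEdl row_mxEl !mxE.
  - by rewrite block_mxEdr row_mxEr !mxE /bot_ok /joint split_r.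
by rewrite det_ublock !det_tr.
Qed.

Lemma garnir_sum : minor f * minor g = \sum_(e | e != garnir0) - \det (garnir_mx e).
Proof.
move: sum_garnir; rewrite (bigD1 garnir0) //= det_garnir0 sumrN => /eqP.
by rewrite addr_eq0 => /eqP.
Qed.

Hypothesis lt_gf : (g i < f i)%N.
Hypothesis f_mono : forall a : 'I_m, (i <= a)%N -> (f i <= f a)%N.
Hypothesis g_mono : forall b : 'I_m, (b <= i)%N -> (g b <= g i)%N.

(** What the exchange does to [f][g], in a form that does not depend on the order of
    the columns, so that it survives the sorting of f' and g'. *)
Definition garnir_shape (f' g' : 'I_m -> 'I_n) : Prop :=
  [/\ (\sum_a f' a < \sum_a f a)%N,
      forall a, (exists b, f' a = f b) \/
                (exists2 b, f' a = g b & (g b < f i)%N)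
    & forall a, (exists b, g' a = g b) \/
                (exists2 b, g' a = f b & (g i < f b)%N)].

Let sum_top (s : 'S_(m + m)) (e : pred 'I_(m + m)) (F : 'I_(m + m) -> nat) :
    (forall k, e k = is_top ((s^-1)%g k)) ->
  (\sum_a F (s (lsh a)) = \sum_(k | e k) F k)%N.
Proof.
move=> eE; rewrite (reindex_inj (@perm_inj _ s)) /=.
rewrite (eq_bigl is_top) => [|k]; last by rewrite eE permK.
rewrite big_split_ord /= -[LHS]addn0; congr (_ + _)%N.
  by apply: eq_bigl => a; rewrite is_top_l.
by rewrite big_pred0 // => a; apply: is_top_r.
Qed.

(** A nonzero Leibniz term t of the determinant must send the columns chosen for the
    top to the top rows, so the inverse of t brings the matrix to block diagonal
    form and the determinant is a signed product of two minors.  The sum of f'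
    is smaller than that of f because as many entries, all at least f i, leave the
    top as entries, all at most g i, enter it. *)
Lemma garnir_term e : e != garnir0 -> \det (garnir_mx e) = 0 \/
  exists f' g' (b : bool), garnir_shape f' g' /\
    \det (garnir_mx e) = (-1) ^+ b * (minor f' * minor g').
Proof.
move=> ne_e0; set A := garnir_mx e.
have [t /forallP nzA | allA] :=
    pickP (fun t : 'S_(m + m) => [forall k, A k (t k) != 0]); last first.
  left; apply: big1 => t _; have /negbT := allA t.
  by rewrite negb_forall => /existsP[k /negPn/eqP Ak]; rewrite (prod_eq0 (i := k)) ?mulr0.
right; pose s := (t^-1)%g.
have eE k : e k = is_top (t k).
  move: (nzA k); rewrite /A mxE; case: (split_ordP (t k)) => a ->.
    by rewrite is_top_l; case: (e k) => //; rewrite row_mxEl mxE eqxx.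
  by rewrite is_top_r; case: (e k) => //; rewrite row_mxEr mxE eqxx.
have tsK k : t (s k) = k by rewrite permKV.
have okT k : e k -> top_ok k.
  move=> ek; move: (nzA k) (eE k); rewrite /A mxE ek.
  case: (split_ordP (t k)) => a ->; last by rewrite is_top_r.
  by rewrite row_mxEl mxE; case: top_ok => //; rewrite eqxx.
have okB k : ~~ e k -> bot_ok k.
  move=> ek; move: (nzA k) (eE k); rewrite /A mxE (negPf ek).
  case: (split_ordP (t k)) => a ->; first by rewrite is_top_l.
  by rewrite row_mxEr mxE; case: bot_ok => //; rewrite eqxx.
exists (fun a => joint (s (lsh a))), (fun a => joint (s (rsh a))), (odd_perm s).
split; [split | ].
- have sum_e (F : 'I_(m + m) -> nat) := sum_top (s := s) (e := e) F.
  have {}sum_e F : (\sum_a F (s (lsh a)) = \sum_(k | e k) F k)%N.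
    by apply: sum_e => k; rewrite invgK.
  have sum_0 F : (\sum_a F (lsh a) = \sum_(k | is_top k) F k)%N.
    rewrite -(sum_top (s := 1%g)) => [|k]; last by rewrite invg1 perm1.
    by apply: eq_bigr => a _; rewrite perm1.
  rewrite /= (sum_e joint); have -> : (\sum_a f a = \sum_(k | is_top k) joint k)%N.
    by rewrite -(sum_0 joint); apply: eq_bigr => a _; rewrite /joint split_l.
  rewrite (bigID is_top) [X in (_ < X)%N](bigID e) /=.
  under [X in (_ < X + _)%N]eq_bigl => k do rewrite andbC.
  rewrite ltn_add2l.
  (* B1 are the columns entering the top, B2 those leaving it. *)
  set B1 := fun k => e k && ~~ is_top k; set B2 := fun k => is_top k && ~~ e k.
  have eq_card : (\sum_(k | B1 k) 1 = \sum_(k | B2 k) 1)%N.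
    have := sum_e (fun=> 1%N); rewrite (sum_0 (fun=> 1%N)).
    rewrite (bigID e) [X in _ = X](bigID is_top) /=.
    under [X in (X + _ = _)%N]eq_bigl => k do rewrite andbC.
    by move/addnI.
  have q_gt0 : (0 < \sum_(k | B2 k) 1)%N.
    have [k ne_k] : exists k, e k != is_top k.
      apply/existsP; apply: contraR ne_e0; rewrite negb_exists => /forallP eq_e.
      by apply/eqP/ffunP=> k; rewrite ffunE; apply/eqP/negPn/eq_e.
    have [B1k | B2k] : B1 k \/ B2 k.
    - by move: ne_k; rewrite /B1 /B2; case: (e k); case: is_top; auto.
    - by rewrite -eq_card (bigD1 k).
    - by rewrite (bigD1 k).
  apply: (@leq_ltn_trans ((\sum_(k | B1 k) 1) * g i)).
    rewrite big_distrl /=; apply: leq_sum => k /andP[/okT]; rewrite mul1n.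
    rewrite /top_ok /is_top /joint; case: split => // b le_b _.
    exact: g_mono.
  apply: (@leq_trans ((\sum_(k | B2 k) 1) * f i)).
    by rewrite eq_card ltn_pmul2l.
  rewrite big_distrl /=; apply: leq_sum => k /andP[+ /okB]; rewrite mul1n.
  rewrite /bot_ok /is_top /joint; case: split => // b _ le_b.
  exact: f_mono.
- move=> a; have : e (s (lsh a)) by rewrite eE tsK is_top_l.
  move/okT; rewrite /top_ok /joint; case: split => b; first by left; exists b.
  by move=> /g_mono le_b; right; exists b => //; apply: leq_ltn_trans lt_gf.
- move=> a; have : ~~ e (s (rsh a)) by rewrite eE tsK is_top_r.
  move/okB; rewrite /bot_ok /joint; case: split => b; last by left; exists b.
  by move=> /f_mono le_b; right; exists b => //; apply: leq_trans lt_gf _.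
have -> : A = row_perm (s^-1)%g (block_mx (colsub (fun a => joint (s (lsh a))) X)^T 0 0
                                     (colsub (fun a => joint (s (rsh a))) X)^T).
  apply/matrixP=> k r; rewrite [RHS]mxE.
  have [k0 ->] : exists k0, k = s k0 by exists (t k); rewrite permK.
  rewrite permK [LHS]mxE eE tsK.
  case: (split_ordP k0) => a ->; case: (split_ordP r) => b ->.
  - rewrite is_top_l block_mxEul row_mxEl !mxE okT //.
    by rewrite eE tsK is_top_l.
  - by rewrite is_top_l block_mxEur row_mxEr !mxE.
  - by rewrite is_top_r block_mxEdl row_mxEl !mxE.
  - rewrite is_top_r block_mxEdr row_mxEr !mxE okB //.
    by rewrite eE tsK is_top_r.
by rewrite row_permE det_mulmx det_perm odd_permV det_ublock !det_tr.
Qed.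

End Garnir.

(** * Increasing sequences and leading monomials of minors *)

Section Sorting.

Variables (m n : nat).
Implicit Types (f g : 'I_m -> 'I_n) (s : 'S_m).

Definition increasing f := forall i j : 'I_m, (i < j)%N -> (f i < f j)%N.

Lemma increasing_le f (i j : 'I_m) : increasing f -> (i <= j)%N -> (f i <= f j)%N.
Proof.
move=> inc_f; rewrite leq_eqVlt => /orP[/eqP/val_inj-> // | /inc_f].
exact: ltnW.
Qed.

Lemma increasing_inj f : increasing f -> injective f.
Proof.
move=> inc_f i j eq_f; apply: val_inj; apply/eqP.
by case: ltngtP => // /inc_f; rewrite eq_f ltnn.
Qed.

(** A permutation that fixes everything below i cannot send i below i; this is the
    combinatorial reason why the diagonal term of a minor is its initial term. *)
Lemma perm_fixed_below_le s (i : 'I_m) :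
  (forall j : 'I_m, (j < i)%N -> s j = j) -> (i <= s i)%N.
Proof.
move=> fix_s; rewrite leqNgt; apply/negP => lt_si.
by have /perm_inj e := fix_s _ lt_si; rewrite e ltnn in lt_si.
Qed.

Lemma perm_first_moved s : s != 1%g ->
  exists2 i : 'I_m, (i < s i)%N & forall j : 'I_m, (j < i)%N -> s j = j.
Proof.
move=> ne_s1; have [i0 s_i0] : exists i, s i != i.
  apply/existsP; apply: contraR ne_s1; rewrite negb_exists => /forallP fix_s.
  by apply/eqP/permP=> i; rewrite perm1; apply/eqP/negPn/fix_s.
case: (@arg_minnP _ i0 (fun i => s i != i) (fun i : 'I_m => i : nat) s_i0) => i ne_i min_i.
have fix_s (j : 'I_m) : (j < i)%N -> s j = j.
  by move=> lt_ji; apply/eqP; apply: contraTT lt_ji => /min_i; rewrite -leqNgt.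
exists i => //; rewrite ltn_neqAle perm_fixed_below_le // andbT.
by rewrite eq_sym.
Qed.

(** The sorting permutation is the inverse of the rank i |-> #{j | f j < f i}. *)
Lemma sorting_perm f : injective f -> exists s, increasing (f \o s).
Proof.
move=> inj_f; pose below i := [set j | (f j < f i)%N].
have lt_r i : (#|below i| < m)%N.
  rewrite -[X in (_ < X)%N]card_ord; apply: proper_card; apply/properP.
  by split; [apply/subsetP | exists i; rewrite // inE ltnn].
pose r i := Ordinal (lt_r i).
have r_lt i j : (f i < f j)%N -> (r i < r j)%N.
  move=> lt_ij; apply: proper_card; apply/properP; split.
    by apply/subsetP=> k; rewrite !inE => /ltn_trans; apply.
  by exists i; rewrite !inE ?ltnn.
have inj_r : injective r.
  move=> i j eq_r; apply/inj_f/val_inj/eqP.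
  by case: ltngtP => // /r_lt; rewrite eq_r ltnn.
exists (perm inj_r)^-1%g => i j lt_ij /=; rewrite ltnNge leq_eqVlt; apply/negP.
case/orP=> [/eqP/val_inj/inj_f/perm_inj e | /r_lt]; first by rewrite e ltnn in lt_ij.
by rewrite -!(permE inj_r) !permKV ltnNge ltnW.
Qed.

End Sorting.

Section Minors.

Variables (K : fieldType) (m n : nat).
Local Notation R := {mpoly K[m * n]}.
Local Notation minor := (@maxminor K m n).
Local Notation lex := (lex_order (m * n)).
Local Notation at_ u i j := ((u : 'X_{1..m * n}) (mxvec_index i j)).
Implicit Types (f g c d : 'I_m -> 'I_n) (s : 'S_m) (p q : R) (u v w : 'X_{1..m * n}).

(** The exponent of x_(1, f 1) ... x_(m, f m). *)
Definition diag f : 'X_{1..m * n} := (\sum_i U_(mxvec_index i (f i)))%MM.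

Lemma mxvec_index_eq (i i' : 'I_m) (j j' : 'I_n) :
  (mxvec_index i j == mxvec_index i' j') = (i == i') && (j == j').
Proof.
apply/eqP/andP=> [e | [/eqP-> /eqP->] //].
suff: (i, j) = (i', j') by case=> -> ->.
by apply: enum_rank_inj; apply: (can_inj (cast_ordK _)) e.
Qed.

Lemma entryP u v : (forall i j, at_ u i j = at_ v i j) -> u = v.
Proof. by move=> eq_uv; apply/mnmP=> k; case/mxvec_indexP: k. Qed.

Lemma mnm1_entry (i i' : 'I_m) (j j' : 'I_n) :
  at_ U_(mxvec_index i j)%MM i' j' = ((i == i') && (j == j')) :> nat.
Proof. by rewrite mnm1E mxvec_index_eq. Qed.

Lemma diag_entry f (i : 'I_m) (j : 'I_n) : at_ (diag f) i j = (f i == j) :> nat.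
Proof.
rewrite /diag mnm_sumE (bigD1 i) //= big1 ?addn0 => [|k ne_ki].
  by rewrite mnm1_entry eqxx.
by rewrite mnm1_entry (negPf ne_ki).
Qed.

Lemma eq_diag f g : f =1 g -> diag f = diag g.
Proof. by move=> eq_fg; apply: eq_bigr => i _; rewrite eq_fg. Qed.

Lemma mdeg_diag f : mdeg (diag f) = m.
Proof.
rewrite /diag mdeg_sum (eq_bigr (fun=> 1%N)) => [|i _]; last by rewrite mdeg1.
by rewrite sum_nat_const card_ord muln1.
Qed.

Lemma diag_monE f : diag_mon K f = 'X_[diag f].
Proof.
rewrite /diag (big_morph _ (@mpolyXD _ K) (@mpolyX0 _ K)); apply: eq_bigr => i _.
by rewrite mxE.
Qed.

Lemma lex_entry u v (i : 'I_m) (j : 'I_n) :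
    (forall (i' : 'I_m) j', (i' < i)%N -> at_ u i' j' = at_ v i' j') ->
    (forall j' : 'I_n, (j' < j)%N -> at_ u i j' = at_ v i j') ->
  (at_ u i j < at_ v i j)%N -> lex u v.
Proof.
move=> eq_rows eq_row lt_ij; apply/lex_ltP; exists (mxvec_index i j) => // k.
case/mxvec_indexP: k => i' j'; rewrite !mxvec_index_val => lt_ij'.
have [lt_ii' | lt_i'i | /val_inj e] := ltngtP i i'; last 2 first.
- exact: eq_rows.
- by rewrite -e ltn_add2l in lt_ij' *; apply: eq_row.
suff: (i * n + j < i' * n + j')%N by rewrite ltnNge ltnW.
apply: (@leq_trans (i.+1 * n)); first by rewrite mulSn addnC ltn_add2r.
by apply: leq_trans (leq_addr _ _); rewrite leq_mul2r lt_ii' orbT.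
Qed.

Lemma lex_diag f g (i : 'I_m) :
    (forall k : 'I_m, (k < i)%N -> f k = g k) -> (g i < f i)%N ->
  lex (diag f) (diag g).
Proof.
move=> eq_fg lt_gf; apply: (lex_entry (i := i) (j := g i)).
- by move=> k j lt_ki; rewrite !diag_entry eq_fg.
- move=> j lt_j; rewrite !diag_entry -!val_eqE /= gtn_eqF ?(ltn_trans lt_j) //.
  by rewrite gtn_eqF.
- by rewrite !diag_entry eqxx -val_eqE /= gtn_eqF.
Qed.

Lemma minorE f :
  minor f = \sum_(s : 'S_m) (-1) ^+ s *: 'X_[diag (f \o s)].
Proof.
apply: eq_bigr => s _; rewrite -diag_monE.
have -> : (-1) ^+ s = ((-1) ^+ s)%:MP :> R by rewrite rmorphXn rmorphN1.
by rewrite mul_mpolyC; congr (_ *: _); apply: eq_bigr => i _; rewrite !mxE.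
Qed.

Lemma eq_minor f g : f =1 g -> minor f = minor g.
Proof.
by move=> eq_fg; rewrite !minorE; apply: eq_bigr => s _; rewrite (@eq_diag _ (g \o s)) // => i /=.
Qed.

Lemma minor_perm f s : minor (f \o s) = (-1) ^+ s * minor f.
Proof.
have -> : minor (f \o s) = \det (col_perm s (colsub f (gmx K m n))).
  by congr (\det _); apply/matrixP=> i j; rewrite !mxE.
by rewrite col_permE det_mulmx det_perm odd_permV mulrC.
Qed.

Lemma minor_noninj f : ~ injective f -> minor f = 0.
Proof.
move=> ninj_f; rewrite /maxminor -det_tr.
have [/existsP[i /existsP[j /andP[ne_ij /eqP eq_f]]] | no_coll] :=
    boolP [exists i, exists j, (i != j) && (f i == f j)].
  by apply: (determinant_alternate ne_ij) => k; rewrite !mxE eq_f.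
case: ninj_f => i j eq_f; apply/eqP; apply: contraR no_coll => ne_ij.
by apply/existsP; exists i; apply/existsP; exists j; rewrite ne_ij eq_f eqxx.
Qed.

Lemma injective_or_minor0 f : injective f \/ minor f = 0.
Proof.
have [/injectiveP | ninj] := boolP (injectiveb f); first by left.
by right; apply: minor_noninj => /injectiveP; apply/negP.
Qed.

(** At the first row that s moves, the column grows. *)
Lemma lex_diag_perm f s : increasing f -> s != 1%g -> lex (diag (f \o s)) (diag f).
Proof.
move=> inc_f /perm_first_moved[i lt_i fix_s].
by apply: (lex_diag (i := i)) => [k /fix_s /= -> | ] //; apply: inc_f.
Qed.

(** A minor minus its initial term. *)
Definition tail f : R := \sum_(s : 'S_m | s != 1%g) (-1) ^+ s *: 'X_[diag (f \o s)].

Lemma minor_tail f : minor f = 'X_[diag f] + tail f.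
Proof.
rewrite minorE (bigD1 1%g) //= odd_perm1 expr0 scale1r; congr ('X_[_] + _).
by apply: eq_diag => i /=; rewrite perm1.
Qed.

Lemma tail_span f : increasing f -> lspan (fun p =>
  exists v, [/\ p = 'X_[v], lex v (diag f) & mdeg v = m]) (tail f).
Proof.
move=> inc_f; apply: lspan_sum => s ne_s; apply/lspanZ/lspan_mem.
by exists (diag (f \o s)); split; rewrite ?mdeg_diag //; apply: lex_diag_perm.
Qed.

Lemma lspan_lex_coeff u p : lspan (fun p =>
    exists v, [/\ p = 'X_[v], lex v u & mdeg v = m]) p ->
  forall v, p@_v != 0 -> lex v u.
Proof.
elim=> [|c q r [w [-> lt_wu _]] _ IHr] v; first by rewrite mcoeff0 eqxx.
rewrite mcoeffD mcoeffZ mcoeffX; have [<- // | ne_wv] := eqVneq w v.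
by rewrite mulr0 add0r; apply: IHr.
Qed.

Lemma minor_leads f : increasing f -> leads lex (minor f) (diag f).
Proof.
move=> inc_f; have lt_tail := lspan_lex_coeff (tail_span inc_f).
rewrite minor_tail; split=> [|v].
  rewrite mcoeffD mcoeffX eqxx; have [-> | /lt_tail] := eqVneq (tail f)@_(diag f) 0.
    by rewrite addr0.
  by rewrite mo_irr.
rewrite mcoeffD mcoeffX [diag f == v]eq_sym => nz_v ne_v; apply: lt_tail.
by rewrite (negPf ne_v) add0r in nz_v.
Qed.

Definition within f (lo hi : nat) := forall i, (lo <= f i <= hi)%N.

(** * Straightening a product of two minors *)

Section Straightening.

Variables lo hi lo' hi' : nat.
Hypotheses (le_lo : (lo <= lo')%N) (le_hi : (hi <= hi')%N).

(** Products [c][d] with c <= d entrywise.  The row i of the exponent of such a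
    product is the multiset {c i, d i}, and c i is its smaller element: hence the
    initial monomial determines the pair. *)
Definition std_pair p u := exists c d,
  [/\ increasing c /\ increasing d, forall i, (c i <= d i)%N,
      within c lo hi, within d lo' hi'
    & p = minor c * minor d /\ u = (diag c + diag d)%MM].

(** By induction on the sum of the entries of f: sort f and g, and when g i < f i for
    some i apply the Garnir relation at i.  The new first factor takes its entries
    from f and from entries of g below some f i, so it stays in [lo, hi], and
    symmetrically for the second factor. *)
Lemma straighten f g : within f lo hi -> within g lo' hi' ->
  lspan (fun p => exists u, std_pair p u) (minor f * minor g).
Proof.
have [N] := ubnP (\sum_i f i); elim: N f g => // N IHN f g le_fN f_lh g_lh.
have [inj_f | ->] := injective_or_minor0 f; last by rewrite mul0r; constructor.
have [inj_g | ->] := injective_or_minor0 g; last by rewrite mulr0; constructor.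
have [s inc_f] := sorting_perm inj_f; have [t inc_g] := sorting_perm inj_g.
have sgn_unit (b : bool) (p : R) : (-1) ^+ b * p = (-1) ^+ b *: p.
  by rewrite -mul_mpolyC rmorphXn rmorphN1.
have sgnK (b : bool) (p : R) : (-1) ^+ b *: ((-1) ^+ b *: p) = p.
  by rewrite scalerA -signr_addb addbb expr0 scale1r.
have minor_sorted (h : 'I_m -> 'I_n) (r : 'S_m) :
    minor h = (-1) ^+ r *: minor (h \o r).
  by rewrite minor_perm sgn_unit sgnK.
rewrite (minor_sorted f s) (minor_sorted g t) -scalerAl -scalerAr scalerA.
apply: lspanZ.
have {}le_fN : (\sum_i (f \o s) i < N.+1)%N.
  by rewrite (reindex_inj (@perm_inj _ s)) /= in le_fN.
have {}f_lh : within (f \o s) lo hi by move=> i; apply: f_lh.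
have {}g_lh : within (g \o t) lo' hi' by move=> i; apply: g_lh.
move: (f \o s) (g \o t) => {minor_sorted inj_f inj_g s t}{}f {}g in inc_f inc_g le_fN f_lh g_lh *.
have [/existsP[i lt_gf] | /existsPn le_fg] := boolP [exists i, (g i < f i)%N]; last first.
  apply: lspan_mem; exists (diag f + diag g)%MM, f, g; split=> // i.
  by rewrite leqNgt.
have f_mono (a : 'I_m) : (i <= a)%N -> (f i <= f a)%N by apply: increasing_le.
have g_mono (b : 'I_m) : (b <= i)%N -> (g b <= g i)%N by apply: increasing_le.
rewrite [minor f * _](garnir_sum _ f g i); apply: lspan_sum => e ne_e.
apply: lspanN; have [-> | [f' [g' [b [[lt_sum f'P g'P] ->]]]]] :=
  garnir_term (gmx K m n) lt_gf f_mono g_mono ne_e; first by constructor.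
rewrite sgn_unit; apply: lspanZ; apply: IHN.
- exact: leq_trans lt_sum _.
- move=> a; case: (f'P a) => [[c ->] // | [c -> lt_gb]].
  have /andP[le1 _] := g_lh c; have /andP[_ le2] := f_lh i.
  by rewrite (leq_trans le_lo le1) (leq_trans (ltnW lt_gb) le2).
- move=> a; case: (g'P a) => [[c ->] // | [c -> lt_gb]].
  have /andP[le1 _] := g_lh i; have /andP[_ le2] := f_lh c.
  by rewrite (leq_trans le1 (ltnW lt_gb)) (leq_trans le2 le_hi).
Qed.

Lemma std_pair_leads p u : std_pair p u -> leads lex p u.
Proof. by case=> c [d [[inc_c inc_d] _ _ _ [-> ->]]]; apply: leadsM; apply: minor_leads. Qed.

Lemma ordered_pair_inj c d c' d' :
    (forall i, (c i <= d i)%N) -> (forall i, (c' i <= d' i)%N) ->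
  (diag c + diag d = diag c' + diag d')%MM -> c =1 c' /\ d =1 d'.
Proof.
move=> le_cd le_cd' /mnmP eq_u.
suff eq_i i : c i = c' i /\ d i = d' i by split=> i; case: (eq_i i).
have eqE j : ((c i == j) + (d i == j) = (c' i == j) + (d' i == j))%N.
  by have:= eq_u (mxvec_index i j); rewrite !mnmDE !diag_entry.
have := eqE (c i); have := eqE (d i); have := eqE (c' i).
move: (le_cd i) (le_cd' i); rewrite !eqxx -!val_eqE /= => le1 le2.
have ordE (x y : 'I_n) : x = y :> nat -> x = y by apply: val_inj.
case: (ltngtP (c i) (c' i)) => [lt | lt | /ordE <-].
- by rewrite [d' i == c i :> nat]gtn_eqF ?(leq_trans lt).
- by rewrite [d i == c' i :> nat]gtn_eqF ?(leq_trans lt).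
move=> _ /addnI + _; case: (eqVneq (d' i) (d i)) => [-> // | ne_d].
by case: eqP => // /ordE e; rewrite e eqxx in ne_d.
Qed.

Lemma std_pair_unique p q u : std_pair p u -> std_pair q u -> p = q.
Proof.
case=> c [d [_ le_cd _ _ [-> ->]]] [c' [d' [_ le_cd' _ _ [-> eq_u]]]].
by have [/eq_minor-> /eq_minor->] := ordered_pair_inj le_cd le_cd' eq_u.
Qed.

(** The straightening relation does not control initial monomials term by term, but
    standard pairs have distinct ones, so nothing can cancel at the top: the
    standard pair with the initial monomial of [a][b] occurs with coefficient 1 and
    all others are smaller. *)
Lemma straighten_leads a b : increasing a -> increasing b ->
    within a lo hi -> within b lo' hi' ->
  exists2 p, std_pair p (diag a + diag b)%MM &
    lspan (below lex std_pair (diag a + diag b)%MM) (minor a * minor b - p).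
Proof.
move=> inc_a inc_b a_lh b_lh.
have ab_leads := leadsM (minor_leads inc_a) (minor_leads inc_b).
have [ab1 _] := ab_leads.
have [] := @subduction _ _ lex (@lex_wf _) std_pair std_pair_leads _ _ _
  (straighten a_lh b_lh) (leads_initial ab_leads).
  move=> p q u pu /(std_pair_unique pu) ->; rewrite subrr; constructor.
by move=> p pu; rewrite ab1 scale1r; exists p.
Qed.

End Straightening.

End Minors.

(** * Congruences between products of variables and minors *)

Section Cramer.

Variables (R : comNzRingType) (m n : nat) (X : 'M[R]_(m, n)).

Definition update (c : 'I_m -> 'I_n) (k : 'I_m) (b : 'I_n) : 'I_m -> 'I_n :=
  fun j => if j == k then b else c j.

(** The row i of A *m (\adj A *m y) = \det A *: y, for A the columns c of X and y its
    column b; by Cramer's rule the entry k of \adj A *m y is the minor of A with the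
    column k replaced by y. *)
Lemma cramer_exchange (c : 'I_m -> 'I_n) (i : 'I_m) (b : 'I_n) :
  X i b * \det (colsub c X) =
  \sum_k X i (c k) * \det (colsub (update c k b) X).
Proof.
have /matrixP/(_ i ord0) := mul_scalar_mx (\det (colsub c X)) (col b X).
rewrite -mul_mx_adj -mulmxA !mxE mulrC => <-; apply: eq_bigr => k _.
rewrite mxE; congr (_ * _); rewrite (expand_det_col _ k) mxE.
apply: eq_bigr => j _; rewrite !mxE /update eqxx mulrC; congr (_ * _).
rewrite /cofactor; congr (_ * \det _); apply/matrixP=> l h.
by rewrite !mxE eq_sym (negPf (neq_lift _ _)).
Qed.

End Cramer.

(** Two members of the family have their lower ends and their upper ends in the
    same order, hence are comparable for the product order on the two ends.  Of
    a unit interval complex the proof uses only that its facets are the m-sets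
    contained in some member of such a family. *)
Definition interval_chain (interv : nat -> nat -> Prop) : Prop :=
  forall lo hi lo' hi', interv lo hi -> interv lo' hi' ->
  (lo <= lo')%N && (hi <= hi')%N \/ (lo' <= lo)%N && (hi' <= hi)%N.

Section Lifting.

Variables (K : fieldType) (m n : nat).
Local Notation R := {mpoly K[m * n]}.
Local Notation minor := (@maxminor K m n).
Local Notation lex := (lex_order (m * n)).
Local Notation at_ u i j := ((u : 'X_{1..m * n}) (mxvec_index i j)).
Local Notation X_ i j := (U_(mxvec_index i j))%MM.
Implicit Types (a b c d e : 'I_m -> 'I_n) (s t : nat) (p q r : R).
Implicit Types (u v w alpha beta : 'X_{1..m * n}).

Variable interv : nat -> nat -> Prop.
Hypothesis interv_chain : interval_chain interv.

Definition facet a : Prop :=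
  increasing a /\ exists lo hi, interv lo hi /\ within a lo hi.

(** The index s counts the factors; it is the exponent of t in the Rees algebra. *)
Inductive minor_prod (B : ('I_m -> 'I_n) -> Prop) : nat -> R -> 'X_{1..m * n} -> Prop :=
| minor_prod0 : minor_prod B 0 1 0%MM
| minor_prodS a s p u : B a -> minor_prod B s p u ->
    minor_prod B s.+1 (minor a * p) (diag a + u)%MM.

Definition rees_prod s p u : Prop :=
  exists alpha q v, [/\ minor_prod facet s q v, p = 'X_[alpha] * q & u = (alpha + v)%MM].

(** Besides the initial monomial, the total degree is recorded: it is what keeps
    variables out of the relations between products of minors alone, see
    facet_prod_cong. *)
Definition lower s u p : Prop :=
  exists v, [/\ rees_prod s p v, lex v u & mdeg v = mdeg u].

Definition cong s u p q := lspan (lower s u) (p - q).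

Lemma minor_prodM B s t p q u v : minor_prod B s p u -> minor_prod B t q v ->
  minor_prod B (s + t) (p * q) (u + v)%MM.
Proof.
move=> Bp Bq; elim: Bp => [|a s' p' u' Ba _ IH]; first by rewrite mul1r add0m.
by rewrite addSn -mulrA -addmA; constructor.
Qed.

Lemma minor_prod_sub B B' s p u : (forall a, B a -> B' a) ->
  minor_prod B s p u -> minor_prod B' s p u.
Proof. by move=> BB'; elim=> [|a s' p' u' Ba _ IH]; constructor=> //; apply: BB'. Qed.

Lemma minor_prod_inv B s p u : minor_prod B s p u ->
  if s is s'.+1 then exists a p' u', [/\ B a, minor_prod B s' p' u',
       p = minor a * p' & u = (diag a + u')%MM]
  else p = 1 /\ u = 0%MM.
Proof. by case=> [|a s' p' u' Ba Bp]; [split | exists a, p', u']. Qed.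

Lemma minor_prod_above c s p u : minor_prod (fun a => facet a /\ forall i, (c i <= a i)%N) s p u ->
  forall (i : 'I_m) (j : 'I_n), (j < c i)%N -> at_ u i j = 0%N.
Proof.
elim=> [|a s' p' u' [_ le_ca] _ IH] i j lt_j; first by rewrite mnm0E.
by rewrite mnmDE diag_entry IH // addn0 -val_eqE /= gtn_eqF // (leq_trans lt_j).
Qed.

Lemma rees_prodM s t p q u v : rees_prod s p u -> rees_prod t q v ->
  rees_prod (s + t) (p * q) (u + v)%MM.
Proof.
case=> alpha [p' [u' [Pp -> ->]]] [beta [q' [v' [Qq -> ->]]]].
exists (alpha + beta)%MM, (p' * q'), (u' + v')%MM; split; first exact: minor_prodM.
  by rewrite mpolyXD mulrACA.
by apply/mnmP=> k; rewrite !mnmDE addnACA.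
Qed.

Lemma rees_prodX alpha : rees_prod 0 'X_[alpha] alpha.
Proof.
by exists alpha, 1, 0%MM; split; [constructor | rewrite mulr1 | rewrite addm0].
Qed.

Lemma rees_prod_minors s p u : minor_prod facet s p u -> rees_prod s p u.
Proof. by move=> Pp; exists 0%MM, p, u; rewrite mpolyX0 mul1r add0m. Qed.

Lemma rees_prod_minor a : facet a -> rees_prod 1 (minor a) (diag a).
Proof.
move=> fa; rewrite -[minor a]mulr1 -[diag a]addm0; apply: rees_prod_minors.
exact: minor_prodS fa (minor_prod0 _).
Qed.

Lemma rees_prod1 alpha a : facet a ->
  rees_prod 1 ('X_[alpha] * minor a) (alpha + diag a)%MM.
Proof. by move=> /rees_prod_minor; apply: rees_prodM (rees_prodX _). Qed.

Lemma rees_prod_leads s p u : rees_prod s p u -> leads lex p u.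
Proof.
case=> alpha [q [v [Bq -> ->]]]; apply: leadsM; first exact: leadsX.
elim: Bq => [|a s' p' u' [inc_a _] _ IH]; last by apply: leadsM => //; apply: minor_leads.
by rewrite -mpolyX0; apply: leadsX.
Qed.

Lemma cong_refl s u p : cong s u p p.
Proof. by rewrite /cong subrr; constructor. Qed.

Lemma cong_sym s u p q : cong s u p q -> cong s u q p.
Proof. by move=> pq; rewrite /cong -opprB; apply: lspanN. Qed.

Lemma cong_trans s u q p r : cong s u p q -> cong s u q r -> cong s u p r.
Proof. by move=> pq qr; have := lspanD pq qr; rewrite addrA subrK. Qed.

Lemma congMr s t u v p q r : rees_prod t r v -> cong s u p q ->
  cong (s + t) (u + v)%MM (p * r) (q * r).
Proof.
move=> Qr; rewrite /cong -mulrBl; apply: lspan_mulr => h [w [Qh lt_wu deg_w]].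
apply: lspan_mem; exists (w + v)%MM; split; first exact: rees_prodM.
  exact: mo_add.
by rewrite !mdegD deg_w.
Qed.

(** Up to exchanging a and b, the interval of a comes before that of b in the chain,
    and straightening keeps the factors inside the two intervals. *)
Lemma straighten_facets a b : facet a -> facet b -> exists c d,
  [/\ facet c /\ facet d, forall i, (c i <= d i)%N,
      (diag a + diag b = diag c + diag d)%MM
    & cong 2 (diag a + diag b)%MM (minor a * minor b) (minor c * minor d)].
Proof.
wlog [lo [hi [lo' [hi' [le_lo le_hi Iab]]]]] : a b /
    exists lo hi lo' hi', [/\ (lo <= lo')%N, (hi <= hi')%N
     & [/\ interv lo hi, within a lo hi, interv lo' hi' & within b lo' hi']].
  move=> IH fa fb; have [_ [lo [hi [I1 a_lh]]]] := fa; have [_ [lo' [hi' [I2 b_lh]]]] := fb.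
  have [/andP[le1 le2]|/andP[le1 le2]] := interv_chain I1 I2.
    by apply: IH => //; exists lo, hi, lo', hi'.
  rewrite addmC mulrC; apply: IH => //.
  by exists lo', hi', lo, hi.
move=> [inc_a _] [inc_b _]; have [I1 a_lh I2 b_lh] := Iab.
have pair_facets c d : [/\ increasing c /\ increasing d, forall i, (c i <= d i)%N,
    within c lo hi & within d lo' hi'] -> facet c /\ facet d.
  by case=> [[? ?] _ ? ?]; split; split=> //; [exists lo, hi | exists lo', hi'].
have [_ [c [d [inc le_cd c_lh d_lh [-> eq_u]]]]] :=
  straighten_leads K le_lo le_hi inc_a inc_b a_lh b_lh.
move=> low; exists c, d; split=> //; first exact: pair_facets.
apply: sub_lspan low => q [v [c' [d' [inc' le' c_lh' d_lh' [-> ->]]]] lt_v].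
have [fc' fd'] : facet c' /\ facet d' by apply: pair_facets.
exists (diag c' + diag d')%MM; split=> //; last by rewrite !mdegD !mdeg_diag.
exact: (rees_prodM (rees_prod_minor fc') (rees_prod_minor fd')).
Qed.

(** The rows before i see only the minor: the extra variables are in row i. *)
Lemma exchange_lex_above c (f : 'I_m -> 'I_n) (i r : 'I_m) (j j' : 'I_n) : (r < i)%N ->
    (forall k : 'I_m, (k < r)%N -> f k = c k) -> (c r < f r)%N ->
  lex (X_ i j + diag f)%MM (X_ i j' + diag c)%MM.
Proof.
move=> lt_ri eq_fc lt_cf; apply: (lex_entry (i := r) (j := c r)).
- move=> k l lt_kr; rewrite !mnmDE !mnm1_entry !diag_entry eq_fc //.
  by rewrite -![i == k]val_eqE /= !(gtn_eqF (ltn_trans lt_kr lt_ri)).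
- move=> l lt_l; rewrite !mnmDE !mnm1_entry !diag_entry -!val_eqE /=.
  by rewrite !(gtn_eqF lt_ri) (gtn_eqF lt_l) (gtn_eqF (ltn_trans lt_l lt_cf)).
rewrite !mnmDE !mnm1_entry !diag_entry eqxx -!val_eqE /=.
by rewrite !(gtn_eqF lt_ri) (gtn_eqF lt_cf).
Qed.

(** Among the terms of the Cramer exchange for x_(i, b) [c] with c (i - 1) < b < c i,
    only k = i has the initial monomial x_(i, b) x_c; for k <> i every monomial of
    the term is smaller.  At the first row r < i where f differs from c its entry
    is larger; if there is none then k > i, and row i is {c k, f i} with f i = b or
    f i >= c i, against {b, c i}. *)
Lemma exchange_lex c (b : 'I_n) (i k : 'I_m) (s : 'S_m) : increasing c -> (b < c i)%N ->
    (forall j : 'I_m, (j < i)%N -> (c j < b)%N) -> k != i ->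
  lex (X_ i (c k) + diag (update c k b \o s))%MM (X_ i b + diag c)%MM.
Proof.
move=> inc_c lt_b gt_b ne_ki; set f := _ \o s.
have fE j : f j = if s j == k then b else c (s j) by [].
have fixed (r : 'I_m) : (r <= i)%N -> (forall q : 'I_m, (q < r)%N -> f q = c q) ->
    forall q : 'I_m, (q < r)%N -> s q = q /\ q != k.
  move=> le_ri eq_f q lt_qr; have := eq_f q lt_qr; rewrite fE.
  case: eqVneq => [_ e | ne /(increasing_inj inc_c) e]; last by rewrite e in ne *.
  by have := gt_b q (leq_trans lt_qr le_ri); rewrite e ltnn.
have [/existsP[r0 r0P] | /existsPn no_r] := boolP [exists r : 'I_m, (r < i)%N && (f r != c r)].
  case: (@arg_minnP _ r0 (fun r : 'I_m => (r < i)%N && (f r != c r)) (fun r : 'I_m => r : nat) r0P).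
  move=> r /andP[lt_ri ne_r] min_r.
  have eq_f (q : 'I_m) : (q < r)%N -> f q = c q.
    move=> lt_qr; apply/eqP; apply: contraT => ne_q; have := min_r q.
    by rewrite (ltn_trans lt_qr lt_ri) ne_q leqNgt lt_qr => /(_ isT).
  apply: (exchange_lex_above _ _ lt_ri eq_f).
  have le_rs : (r <= s r)%N.
    by apply: perm_fixed_below_le => q /(fixed r (ltnW lt_ri) eq_f)[].
  move: ne_r; rewrite fE; case: (eqVneq (s r) k) => [_ _|_ ne_r]; first exact: gt_b r lt_ri.
  apply: inc_c; rewrite ltn_neqAle le_rs andbT.
  by apply: contraNneq ne_r => /val_inj <-.
have eq_f (q : 'I_m) : (q < i)%N -> f q = c q.
  by move=> lt_qi; apply/eqP; have := no_r q; rewrite lt_qi negbK.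
have fix_s := fixed i (leqnn i) eq_f.
have lt_ik : (i < k)%N.
  by rewrite ltn_neqAle eq_sym ne_ki leqNgt; apply/negP => /fix_s[_ /eqP].
have le_is : (i <= s i)%N by apply: perm_fixed_below_le => q /fix_s[].
have eq_rows (i' : 'I_m) j' : (i' < i)%N ->
    at_ (X_ i (c k) + diag f)%MM i' j' = at_ (X_ i b + diag c)%MM i' j'.
  move=> lt_i'; rewrite !mnmDE !mnm1_entry !diag_entry eq_f //.
  by rewrite -!val_eqE /= ![i == i' :> nat]gtn_eqF.
have lt_cik := inc_c _ _ lt_ik.
have [s_i | ne_si] := eqVneq (s i) k.
  apply: (lex_entry (i := i) (j := c i)) => // [j lt_j |];
    rewrite !mnmDE !mnm1_entry !diag_entry eqxx fE s_i eqxx -!val_eqE /=.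
    by rewrite [c k == j :> nat]gtn_eqF ?(ltn_trans lt_j) // [c i == j :> nat]gtn_eqF // addn0.
  by rewrite [c k == _ :> nat]gtn_eqF // eqxx ltn_eqF.
have le_ci := increasing_le inc_c le_is.
apply: (lex_entry (i := i) (j := b)) => // [j lt_j |];
  rewrite !mnmDE !mnm1_entry !diag_entry eqxx fE (negPf ne_si) -!val_eqE /=.
  have lt_ji := ltn_trans lt_j lt_b.
  rewrite (gtn_eqF lt_j) (gtn_eqF lt_ji) (gtn_eqF (ltn_trans lt_ji lt_cik)).
  by rewrite (gtn_eqF (leq_trans lt_ji le_ci)).
rewrite eqxx (gtn_eqF lt_b) (gtn_eqF (ltn_trans lt_b lt_cik)).
by rewrite (gtn_eqF (leq_trans lt_b le_ci)).
Qed.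

Lemma update_diag c (i : 'I_m) (b : 'I_n) :
  (X_ i (c i) + diag (update c i b) = X_ i b + diag c)%MM.
Proof.
apply: entryP => k j; rewrite !mnmDE !mnm1_entry !diag_entry /update eq_sym.
by case: eqVneq => [->|] //=; rewrite addnC.
Qed.

(** The terms k <> i of the Cramer exchange are either zero or, after sorting, plus or
    minus a variable times the minor of a facet, since all the columns involved lie
    in one interval. *)
Lemma exchange_cong c (b : 'I_n) (i : 'I_m) lo hi alpha : increasing c -> (b < c i)%N ->
    (forall j : 'I_m, (j < i)%N -> (c j < b)%N) ->
    interv lo hi -> within c lo hi -> (lo <= b <= hi)%N ->
  cong 1 (alpha + (X_ i b + diag c))%MM ('X_[alpha + X_ i b] * minor c)
    ('X_[alpha + X_ i (c i)] * minor (update c i b)).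
Proof.
move=> inc_c lt_b gt_b I_lh c_lh b_lh.
have gmxE (j : 'I_m) (k : 'I_n) : 'X_[X_ j k] = gmx K m n j k by rewrite mxE.
rewrite /cong !mpolyXD !gmxE -!mulrA -mulrBr [gmx K m n i b * _]cramer_exchange.
rewrite (bigD1 i) //= addrC addrK mulr_sumr; apply: lspan_sum => k ne_ki.
have [inj_f | eq0] := injective_or_minor0 K (update c k b); last first.
  by rewrite -/(minor _) eq0 !mulr0; constructor.
have [s inc_f] := sorting_perm inj_f.
have -> : \det (colsub (update c k b) (gmx K m n)) = (-1) ^+ s *: minor (update c k b \o s).
  rewrite minor_perm -mul_mpolyC rmorphXn rmorphN1 mulrA -signr_addb addbb.
  by rewrite expr0 mul1r.
rewrite -!scalerAr; apply/lspanZ/lspan_mem.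
exists (alpha + (X_ i (c k) + diag (update c k b \o s)))%MM; split.
- rewrite -gmxE mulrA -mpolyXD addmA; apply: rees_prod1; split=> //.
  by exists lo, hi; split=> // j; rewrite /= /update; case: ifP.
- by apply: mo_addl; apply: exchange_lex.
- by rewrite !mdegD !mdeg1 !mdeg_diag.
Qed.

Lemma entry_sub alpha (i : 'I_m) (j : 'I_n) : (0 < at_ alpha i j)%N ->
  exists gamma, alpha = (gamma + X_ i j)%MM.
Proof.
move=> gt0; exists (alpha - X_ i j)%MM; rewrite submK //.
apply/mnm_lepP=> k; case/mxvec_indexP: k => i' j'; rewrite mnm1_entry.
by case: eqVneq => [<-|] //=; case: eqVneq => [<-|].
Qed.

Lemma diag_sub alpha e : (forall i : 'I_m, (0 < at_ alpha i (e i))%N) ->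
  exists gamma, alpha = (gamma + diag e)%MM.
Proof.
move=> gt0; exists (alpha - diag e)%MM; rewrite submK //.
apply/mnm_lepP=> k; case/mxvec_indexP: k => i j; rewrite diag_entry.
by case: eqVneq => [<-|].
Qed.

(** When c and e agree at i0 one can walk from c down to e by changing one entry at a
    time, each step inside a single interval.  Above i0 the entries decrease
    while staying at least c i0, hence in the interval of c.  Once they agree with e
    above i0, the remaining entries of c lie between those of e and e i0, hence in the
    interval of e.  Changing the least index first keeps the sequence increasing. *)
Lemma next_exchange c e (i0 i1 : 'I_m) : facet c -> facet e ->
    (forall i, (e i <= c i)%N) -> c i0 = e i0 -> c i1 != e i1 ->
  exists i : 'I_m, [/\ (e i < c i)%N, forall j : 'I_m, (j < i)%N -> (c j < e i)%N
    & exists lo hi, [/\ interv lo hi, within c lo hi & (lo <= e i <= hi)%N]].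
Proof.
move=> [inc_c [lo [hi [Ic c_lh]]]] [inc_e [lo' [hi' [Ie e_lh]]]] le_ec eq0 ne1.
have lt_ec i : c i != e i -> (e i < c i)%N.
  by move=> ne_i; rewrite ltn_neqAle le_ec andbT; apply: contra ne_i => /eqP/val_inj->.
have [/existsP[i2 P2] | /existsPn no_i] := boolP [exists i : 'I_m, (i0 < i)%N && (c i != e i)].
  case: (@arg_minnP _ i2 (fun i : 'I_m => (i0 < i)%N && (c i != e i)) (fun i : 'I_m => i : nat) P2).
  move=> i /andP[lt_i0 ne_i] min_i; exists i; split; first exact: lt_ec.
    move=> j lt_ji; case: (leqP j i0) => [le_j | lt_0j].
      by apply: leq_ltn_trans (increasing_le inc_c le_j) _; rewrite eq0 inc_e.
    have /eqP-> : c j == e j; last exact: inc_e.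
    by apply: contraTT lt_ji => ne_j; rewrite -leqNgt min_i // lt_0j.
  exists lo, hi; split=> //; have /andP[lo_c _] := c_lh i0; have /andP[_ c_hi] := c_lh i.
  by rewrite (leq_trans (le_ec i) c_hi) andbT (leq_trans lo_c) // eq0 ltnW // inc_e.
have eq_above (j : 'I_m) : (i0 < j)%N -> c j = e j.
  by move=> lt_j; apply/eqP; have := no_i j; rewrite lt_j negbK.
case: (@arg_minnP _ i1 (fun i : 'I_m => c i != e i) (fun i : 'I_m => i : nat) ne1).
move=> i ne_i min_i; exists i; split; first exact: lt_ec.
  move=> j lt_ji; have /eqP-> : c j == e j; last exact: inc_e.
  by apply: contraTT lt_ji => ne_j; rewrite -leqNgt min_i.
exists lo', hi'; split=> // j; have /andP[lo_e e_hi] := e_lh j.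
rewrite (leq_trans lo_e) //=; case: (leqP j i0) => [le_j | /eq_above-> //].
apply: leq_trans (increasing_le inc_c le_j) _; rewrite eq0.
by case/andP: (e_lh i0).
Qed.

Lemma update_increasing c (b : 'I_n) (i : 'I_m) : increasing c -> (b < c i)%N ->
  (forall j : 'I_m, (j < i)%N -> (c j < b)%N) -> increasing (update c i b).
Proof.
move=> inc_c lt_b gt_b j k lt_jk; rewrite /update.
have [ej | ne_j] := eqVneq j i; have [ek | ne_k] := eqVneq k i.
- by rewrite ej ek ltnn in lt_jk.
- by apply: ltn_trans lt_b _; apply: inc_c; rewrite -ej.
- by apply: gt_b; rewrite -ek.
- exact: inc_c.
Qed.

Lemma path_cong c e (i0 : 'I_m) alpha beta : facet c -> facet e ->
    (forall i, (e i <= c i)%N) -> c i0 = e i0 ->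
    (alpha + diag c = beta + diag e)%MM ->
  cong 1 (alpha + diag c)%MM ('X_[alpha] * minor c) ('X_[beta] * minor e).
Proof.
have [N] := ubnP #|[set i | c i != e i]|.
elim: N c alpha => // N IHN c alpha ltN fc fe le_ec eq0 eq_u.
have [/existsP[i1 ne1] | /existsPn eq_ce] := boolP [exists i, c i != e i]; last first.
  have eq_c : c =1 e by move=> i; apply/eqP/negPn/eq_ce.
  by move: eq_u; rewrite (eq_minor K eq_c) (eq_diag eq_c) => /addIm ->; apply: cong_refl.
have [i [lt_i gt_i [lo [hi [I_lh c_lh e_lh]]]]] := next_exchange fc fe le_ec eq0 ne1.
have [inc_c _] := fc.
have [gamma def_alpha] : exists gamma, alpha = (gamma + X_ i (e i))%MM.
  apply: entry_sub; move/mnmP/(_ (mxvec_index i (e i))): eq_u.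
  by rewrite !mnmDE !diag_entry eqxx -val_eqE /= gtn_eqF // addn0 addn1 => ->.
have -> : (alpha + diag c = gamma + (X_ i (e i) + diag c))%MM by rewrite def_alpha addmA.
rewrite def_alpha; apply: cong_trans (exchange_cong gamma inc_c lt_i gt_i I_lh c_lh e_lh) _.
have eq_u' : (gamma + (X_ i (e i) + diag c) =
    gamma + X_ i (c i) + diag (update c i (e i)))%MM by rewrite -update_diag addmA.
rewrite eq_u'; apply: IHN => //.
- rewrite ltnS in ltN; apply: leq_trans ltN; apply: proper_card; apply/properP; split.
    by apply/subsetP=> j; rewrite !inE /update; case: (eqVneq j i) => [->|//]; rewrite eqxx.
  exists i; rewrite !inE /update ?eqxx //.
  by apply: contraTneq lt_i => ->; rewrite ltnn.
- split; first exact: update_increasing.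
  by exists lo, hi; split=> // j; rewrite /update; case: ifP.
- by move=> j; rewrite /update; case: (eqVneq j i) => [->|].
- by rewrite /update; case: (eqVneq i0 i) => [->|].
- by rewrite -eq_u' addmA -def_alpha.
Qed.

(** The trivial relation [e][c] = [c][e], with one factor of each side replaced by its
    initial monomial. *)
Lemma koszul_cong c e gamma : facet c -> facet e ->
  cong 1 (gamma + (diag e + diag c))%MM ('X_[gamma + diag e] * minor c)
    ('X_[gamma + diag c] * minor e).
Proof.
move=> fc fe.
have low a b : facet a -> facet b ->
    lspan (lower 1 (gamma + (diag a + diag b))%MM) (tail K a * minor b * 'X_[gamma]).
  move=> [inc_a _] fb; rewrite -mulrA; apply: lspan_mulr (tail_span K inc_a).
  move=> q [v [-> lt_v deg_v]].
  apply: lspan_mem; exists (gamma + (v + diag b))%MM; split.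
  - rewrite mulrA mulrC mulrA -mpolyXD addmA; exact: rees_prod1.
  - by apply: mo_addl; apply: mo_add.
  - by rewrite !mdegD deg_v !mdeg_diag.
rewrite /cong !mpolyXD.
have -> : 'X_[gamma] * 'X_[diag e] * minor c - 'X_[gamma] * 'X_[diag c] * minor e
    = tail K c * minor e * 'X_[gamma] - tail K e * minor c * 'X_[gamma].
  by rewrite !minor_tail; ring.
apply: lspanB; last exact: low.
by rewrite [(diag e + _)%MM]addmC; apply: low.
Qed.

(** This is the statement that the minors of the facets behave as a Groebner basis.
    If c and e share no entry then alpha contains all of x_e and beta all of x_c,
    and the Koszul relation applies; otherwise the walk of path_cong does.  When
    c and e lie in no common interval, single exchanges in the first case may
    leave the facets. *)
Lemma replace_cong c e alpha beta : facet c -> facet e ->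
    (forall i, (e i <= c i)%N) -> (alpha + diag c = beta + diag e)%MM ->
  cong 1 (alpha + diag c)%MM ('X_[alpha] * minor c) ('X_[beta] * minor e).
Proof.
move=> fc fe le_ec eq_u.
have [/existsP[i0 /eqP eq0] | /existsPn ne_ce] := boolP [exists i, c i == e i].
  exact: (path_cong fc fe le_ec eq0 eq_u).
have [gamma def_alpha] : exists gamma, alpha = (gamma + diag e)%MM.
  apply: diag_sub => i; move/mnmP/(_ (mxvec_index i (e i))): eq_u.
  by rewrite !mnmDE !diag_entry eqxx (negPf (ne_ce i)) addn0 addn1 => ->.
have def_beta : beta = (gamma + diag c)%MM.
  apply: (@addIm _ (diag e)); rewrite -eq_u def_alpha.
  by rewrite -!addmA [(diag c + _)%MM]addmC.
by rewrite def_beta def_alpha -addmA; apply: koszul_cong.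
Qed.

(** Bubble the minimum to the front: each straightening of the first factor with the
    next one replaces it by their meet. *)
Lemma least_first a s p u : facet a -> minor_prod facet s p u ->
  exists c q v, [/\ facet c,
    minor_prod (fun d => facet d /\ forall i, (c i <= d i)%N) s q v,
    (diag a + u = diag c + v)%MM
  & cong s.+1 (diag a + u)%MM (minor a * p) (minor c * q)].
Proof.
move=> fa; elim=> [|b s' p' u' fb _ [c [q [v [fc Bq eq_u cong_pq]]]]].
  by exists a, 1, 0%MM; split=> //; [constructor | apply: cong_refl].
have [d [e [[fd fe] le_de eq_cb cong_cb]]] := straighten_facets fc fb.
have le_dc : forall i, (d i <= c i)%N.
  move=> i; move/mnmP/(_ (mxvec_index i (c i))): eq_cb.
  rewrite !mnmDE !diag_entry eqxx; case: (eqVneq (d i) (c i)) => [-> //|_].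
  by case: (eqVneq (e i) (c i)) => // <- _; apply: le_de.
have Bq' : minor_prod facet s' q v by apply: minor_prod_sub Bq => ? [].
exists d, (minor e * q), (diag e + v)%MM; split=> //.
- constructor=> //; apply: minor_prod_sub Bq => h [fh le_ch]; split=> // i.
  exact: leq_trans (le_dc i) (le_ch i).
- apply/mnmP=> k; move/mnmP/(_ k): eq_u; move/mnmP/(_ k): eq_cb.
  by rewrite !mnmDE; lia.
have -> : minor a * (minor b * p') = minor a * p' * minor b by ring.
have -> : (diag a + (diag b + u') = diag a + u' + diag b)%MM.
  by apply/mnmP=> k; rewrite !mnmDE -addnA [(u' k + _)%N]addnC.
have := congMr (rees_prod_minor fb) cong_pq; rewrite addn1; move/cong_trans; apply.
have -> : minor c * q * minor b = minor c * minor b * q by ring.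
have -> : minor d * (minor e * q) = minor d * minor e * q by rewrite mulrA.
have -> : (diag a + u' + diag b = diag c + diag b + v)%MM.
  by rewrite eq_u; apply/mnmP=> k; rewrite !mnmDE -!addnA [(v k + _)%N]addnC.
exact: (congMr (rees_prod_minors Bq') cong_cb).
Qed.

Definition meet a b : 'I_m -> 'I_n := fun i => if (a i <= b i)%N then a i else b i.

Lemma meet_facet a b : facet a -> facet b -> facet (meet a b).
Proof.
move=> [inc_a [lo [hi [Ia a_lh]]]] [inc_b [lo' [hi' [Ib b_lh]]]]; split.
  move=> i j lt_ij; have lt_a := inc_a i j lt_ij; have lt_b := inc_b i j lt_ij.
  rewrite /meet; case: (leqP (a i)) => lt_i; case: (leqP (a j)) => lt_j //.
    exact: leq_ltn_trans lt_i lt_b.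
  exact: ltn_trans lt_i lt_a.
have meet_le i : (meet a b i <= a i)%N && (meet a b i <= b i)%N.
  by rewrite /meet; case: (leqP (a i) (b i)) => [->|/ltnW->]; rewrite leqnn.
have [/andP[le_lo le_hi] | /andP[le_lo le_hi]] := interv_chain Ia Ib.
  exists lo, hi; split=> // i; have /andP[le_a _] := meet_le i.
  have /andP[lo_a a_hi] := a_lh i; have /andP[lo_b _] := b_lh i.
  rewrite (leq_trans le_a) // andbT /meet; case: ifP => // _.
  exact: leq_trans lo_b.
exists lo', hi'; split=> // i; have /andP[_ le_b] := meet_le i.
have /andP[lo_b b_hi] := b_lh i; have /andP[lo_a _] := a_lh i.
rewrite (leq_trans le_b) // andbT /meet; case: ifP => // _.
exact: leq_trans lo_a.
Qed.

(** As all remaining factors are at least c, an entry e i < c i occurring in row i of u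
    can only come from alpha, so replace_cong applies to the first factor. *)
Lemma lower_first c e s p u v alpha : facet c -> facet e ->
    (forall i, (e i <= c i)%N) ->
    minor_prod (fun d => facet d /\ forall i, (c i <= d i)%N) s p v ->
    u = (alpha + (diag c + v))%MM -> (forall i, (0 < at_ u i (e i))%N) ->
  exists2 beta, u = (beta + (diag e + v))%MM &
    cong s.+1 u ('X_[alpha] * (minor c * p)) ('X_[beta] * (minor e * p)).
Proof.
move=> fc fe le_ec Bp def_u u_gt0.
have [beta eq_ab] : exists beta, (alpha + diag c)%MM = (beta + diag e)%MM.
  apply: diag_sub => i; have := u_gt0 i; rewrite def_u !mnmDE diag_entry.
  case: (eqVneq (c i) (e i)) => [_ | ne_i]; first by rewrite addn1.
  rewrite (minor_prod_above Bp) //.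
  by rewrite ltn_neqAle le_ec andbT; apply: contra ne_i => /eqP/val_inj->.
have Bp' : minor_prod facet s p v by apply: minor_prod_sub Bp => ? [].
exists beta; first by rewrite def_u addmA eq_ab addmA.
rewrite !mulrA def_u addmA.
exact: (congMr (rees_prod_minors Bp') (replace_cong fc fe le_ec eq_ab)).
Qed.

(** The lifting condition for the Rees algebra, by induction on the number s of
    minors.  Bring in both products a least factor to the front, c and d; then
    lower both to the meet e of c and d, cancel it, and use the induction
    hypothesis. *)
Lemma rees_prod_cong s p q u : rees_prod s p u -> rees_prod s q u -> cong s u p q.
Proof.
elim: s p q u => [|s IHs] p q u.
  case=> alpha [p' [v [/minor_prod_inv[-> ->] -> ->]]].
  case=> beta [q' [w [/minor_prod_inv[-> ->] -> ]]].
  by rewrite !addm0 => ->; apply: cong_refl.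
case=> alpha [_ [_ [/minor_prod_inv[a [p1 [v1 [fa Bp1 -> ->]]]] -> def_u]]].
case=> beta [_ [_ [/minor_prod_inv[b [q1 [w1 [fb Bq1 -> ->]]]] -> def_u']]].
have [c [p2 [v2 [fc Bp2 eq_v cong_p]]]] := least_first fa Bp1.
have [d [q2 [w2 [fd Bq2 eq_w cong_q]]]] := least_first fb Bq1.
rewrite eq_v in def_u cong_p; rewrite eq_w in def_u' cong_q.
pose e := meet c d; have fe : facet e by apply: meet_facet.
have le_e i : (e i <= c i)%N && (e i <= d i)%N.
  by rewrite /e /meet; case: (leqP (c i) (d i)) => [->|/ltnW->]; rewrite leqnn.
have u_gt0 i : (0 < at_ u i (e i))%N.
  rewrite /e /meet; case: ifP => _.
    by rewrite def_u !mnmDE diag_entry eqxx addnCA.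
  by rewrite def_u' !mnmDE diag_entry eqxx addnCA.
have [alpha' def_a cong_p'] : exists2 alpha', u = (alpha' + (diag e + v2))%MM &
    cong s.+1 u ('X_[alpha] * (minor c * p2)) ('X_[alpha'] * (minor e * p2)).
  by apply: lower_first => // i; case/andP: (le_e i).
have [beta' def_b cong_q'] : exists2 beta', u = (beta' + (diag e + w2))%MM &
    cong s.+1 u ('X_[beta] * (minor d * q2)) ('X_[beta'] * (minor e * q2)).
  by apply: lower_first => // i; case/andP: (le_e i).
have mulX gamma r r' v : cong s.+1 v r r' ->
    cong s.+1 (gamma + v)%MM ('X_[gamma] * r) ('X_[gamma] * r').
  move/(congMr (rees_prodX gamma)); rewrite addn0.
  by rewrite ![_ * 'X_[gamma]]mulrC addmC.
have {}cong_p : cong s.+1 u ('X_[alpha] * (minor a * p1)) ('X_[alpha] * (minor c * p2)).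
  by rewrite def_u; apply: mulX.
have {}cong_q : cong s.+1 u ('X_[beta] * (minor b * q1)) ('X_[beta] * (minor d * q2)).
  by rewrite def_u'; apply: mulX.
apply: cong_trans (cong_trans cong_p cong_p') _.
apply: cong_sym; apply: cong_trans (cong_trans cong_q cong_q') _; apply: cong_sym.
have sub_fac h r v : minor_prod (fun d => facet d /\ forall i, (h i <= d i)%N) s r v ->
    minor_prod facet s r v by apply: minor_prod_sub => ? [].
have Qp : rees_prod s ('X_[alpha'] * p2) (alpha' + v2)%MM.
  by exists alpha', p2, v2; split=> //; apply: sub_fac Bp2.
have eq_res : (alpha' + v2 = beta' + w2)%MM.
  apply: (@addIm _ (diag e)); rewrite -!addmA [(v2 + _)%MM]addmC [(w2 + _)%MM]addmC.
  by rewrite -def_a.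
have Qq : rees_prod s ('X_[beta'] * q2) (alpha' + v2)%MM.
  by rewrite eq_res; exists beta', q2, w2; split=> //; apply: sub_fac Bq2.
have := congMr (rees_prod_minor fe) (IHs _ _ _ Qp Qq); rewrite addn1.
have -> : (alpha' + v2 + diag e = u)%MM by rewrite def_a -addmA [(v2 + _)%MM]addmC.
have -> : 'X_[alpha'] * p2 * minor e = 'X_[alpha'] * (minor e * p2) by ring.
by have -> : 'X_[beta'] * q2 * minor e = 'X_[beta'] * (minor e * q2) by ring.
Qed.

End Lifting.

(** * Facets of a unit interval complex *)

Section UnitIntervalFacets.

Variables (m n : nat) (D : {set {set 'I_n}}).
Hypotheses (pure_D : pure_complex m D) (unit_D : unit_interval m D).

(** The family of the vertex sets of the maximal cliques, given by their ends. *)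
Definition clique_interval (lo hi : nat) : Prop :=
  exists u v : 'I_n, [/\ maximal_clique m D (Defs.interval u v), (u < v)%N, lo = u & hi = v].

(** If the ends were in opposite orders, one maximal clique would contain the other. *)
Lemma clique_interval_chain : interval_chain clique_interval.
Proof.
move=> lo hi lo' hi'; wlog le_lo : lo hi lo' hi' / (lo <= lo')%N.
  move=> IH I1 I2; have [le_lo | le_lo] := orP (leq_total lo lo').
    exact: IH _ _ _ _ le_lo I1 I2.
  by have [|] := IH _ _ _ _ le_lo I2 I1; [right | left].
case=> u [v [max_uv lt_uv eq_lo eq_hi]] [u' [v' [max_uv' lt_uv' eq_lo' eq_hi']]].
rewrite {}eq_lo {}eq_lo' {}eq_hi {}eq_hi' in le_lo *.
case: (leqP v v') => [le_v | lt_v]; first by left; rewrite le_lo.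
right; rewrite (ltnW lt_v) andbT.
have sub : Defs.interval u' v' \subset Defs.interval u v.
  apply/subsetP=> i; rewrite !inE => /andP[le1 le2].
  by rewrite (leq_trans le_lo le1) (leq_trans le2 (ltnW lt_v)).
have eq_int := maxsetsup max_uv' (maxsetp max_uv) sub.
have : u \in Defs.interval u v by rewrite inE leqnn ltnW.
by rewrite eq_int inE => /andP[].
Qed.

(** A facet has m elements, so it is itself a clique and lies in a maximal one;
    conversely an m-subset of a clique is a face, and faces with m elements are
    facets by purity. *)
Lemma unit_interval_facetP (a : 'I_m -> 'I_n) :
  is_facet D a <-> facet clique_interval a.
Proof.
have [[_ D_closed] D_pure] := pure_D.
split=> [[inc_a fac_a] | [inc_a [lo [hi [[u [v [max_uv _ -> ->]] a_uv]]]]]]; split=> //.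
  pose F := [set a i | i : 'I_m].
  have card_F : #|F| = m by rewrite card_imset ?card_ord //; apply: increasing_inj.
  have F_D : F \in D by move: fac_a; rewrite inE => /maxsetp.
  have clq_F : is_clique m D F.
    rewrite /is_clique card_F leqnn; apply/forallP=> G; apply/implyP=> /andP[sGF /eqP cG].
    by apply/exists_inP; exists F => //; rewrite inE F_D subxx.
  have [W max_W sFW] := maxset_exists clq_F.
  have [r [u [v [cliques lt_uv _ _ _]]]] := unit_D.
  have [i def_W] := (cliques W).1 max_W.
  exists (u i), (v i); split; first by exists (u i), (v i); rewrite -def_W.
  move=> j; have : a j \in W by apply: (subsetP sFW); apply: imset_f.
  by rewrite def_W inE.
set F := [set a i | i : 'I_m].
have card_F : #|F| = m by rewrite card_imset ?card_ord //; apply: increasing_inj.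
have /andP[_ /forallP/(_ F)/implyP clq] := maxsetp max_uv.
have F_D : F \in D.
  have /clq/exists_inP[G] : (F \subset Defs.interval u v) && (#|F| == m).
    rewrite card_F eqxx andbT; apply/subsetP=> _ /imsetP[i _ ->].
    by rewrite inE; apply: a_uv.
  by rewrite inE => /andP[G_D _]; apply: D_closed.
rewrite inE; apply/maxsetP; split=> // G G_D sFG.
have [H max_H sGH] := maxset_exists (P := fun G : {set 'I_n} => G \in D) G_D.
apply/eqP; rewrite eq_sym eqEcard sFG card_F.
by rewrite -(D_pure H) ?inE // subset_leq_card.
Qed.

End UnitIntervalFacets.

(** * Initial algebras *)

Section AlgebraGenerators.

Variables (K : fieldType) (k : nat).
Local Notation P := {mpoly K[k]}.
Implicit Types (S : P -> Prop) (p q : P).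

Lemma alg_gen_bind S S' p : (forall q, S q -> alg_gen S' q) -> alg_gen S p -> alg_gen S' p.
Proof.
move=> SS'; elim=> [q /SS' // | c | q r _ IHq _ IHr | q r _ IHq _ IHr].
- exact: alg_genC.
- exact: alg_genD.
- exact: alg_genM.
Qed.

Lemma alg_gen1 S : alg_gen S 1.
Proof. by rewrite -mpolyC1; apply: alg_genC. Qed.

Lemma alg_genZ S c p : alg_gen S p -> alg_gen S (c *: p).
Proof. by rewrite -mul_mpolyC; apply: alg_genM; apply: alg_genC. Qed.

Lemma alg_genX S p i : alg_gen S p -> alg_gen S (p ^+ i).
Proof.
move=> Sp; elim: i => [|i IHi]; first by rewrite expr0; apply: alg_gen1.
by rewrite exprS; apply: alg_genM.
Qed.

End AlgebraGenerators.

Section AlgebraOfMinors.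

Variables (K : fieldType) (m n : nat).
Local Notation R := {mpoly K[m * n]}.
Local Notation minor := (@maxminor K m n).
Local Notation lex := (lex_order (m * n)).
Hypothesis m_gt0 : (0 < m)%N.

Variable interv : nat -> nat -> Prop.
Hypothesis interv_chain : interval_chain interv.
Local Notation facet := (facet interv).
Local Notation rees_prod := (rees_prod interv).

Lemma minor_prod_mdeg (B : ('I_m -> 'I_n) -> Prop) s (p : R) u :
  minor_prod B s p u -> mdeg u = (s * m)%N.
Proof.
elim=> [|a s' p' u' _ _ IH]; first by rewrite mdeg0.
by rewrite mdegD mdeg_diag IH mulSn.
Qed.

Let facet_prod (p : R) u := exists s, minor_prod facet s p u.

(** Without variables the total degree of the initial monomial is m times the number
    of factors, so equal initial monomials have equally many factors, and a product
    of the same degree with as many factors has no variable. *)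
Lemma facet_prod_cong p q u : facet_prod p u -> facet_prod q u ->
  lspan (below lex facet_prod u) (p - q).
Proof.
move=> [s Bp] [s' Bq].
have deg_u := minor_prod_mdeg Bp.
have es : s' = s.
  by apply/eqP; rewrite -(eqn_pmul2r m_gt0) -deg_u (minor_prod_mdeg Bq).
rewrite {s'}es in Bq.
apply: sub_lspan (rees_prod_cong interv_chain (rees_prod_minors Bp) (rees_prod_minors Bq)).
move=> r [_ [[alpha [q' [v [Bq' -> ->]]]] lt_v]].
rewrite mdegD (minor_prod_mdeg Bq') deg_u => /eqP.
rewrite -[X in _ == X]add0n eqn_add2r mdeg_eq0 => /eqP alpha0.
rewrite alpha0 add0m in lt_v; rewrite alpha0 mpolyX0 mul1r.
by exists v => //; exists s.
Qed.

Lemma alg_minors_lspan (S : R -> Prop) f :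
    (forall p, S p -> exists2 a, facet a & p = minor a) -> alg_gen S f ->
  lspan (fun p => exists u, facet_prod p u) f.
Proof.
move=> S_minors; have prod1 : lspan (fun p => exists u, facet_prod p u) 1.
  by apply: lspan_mem; exists 0%MM, 0%N; constructor.
elim=> [_ /S_minors[a fa ->] | c | p q _ IHp _ IHq | p q _ IHp _ IHq].
- apply: lspan_mem; exists (diag a + 0)%MM, 1%N; rewrite -[minor a]mulr1.
  exact: minor_prodS fa (minor_prod0 _ _).
- by rewrite -[c%:MP]mulr1 mul_mpolyC; apply: lspanZ.
- exact: lspanD.
apply: lspan_mulr IHp => p' [u [s Bp]]; rewrite mulrC.
apply: lspan_mulr IHq => q' [v [t Bq]].
by apply: lspan_mem; exists (v + u)%MM, (t + s)%N; apply: minor_prodM.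
Qed.

Lemma facet_prod_monomial (S : R -> Prop) s (p : R) u :
    (forall a, facet a -> alg_gen S 'X_[diag a]) -> minor_prod facet s p u ->
  alg_gen S 'X_[u].
Proof.
move=> S_diag; elim=> [|a s' p' u' fa _ IH]; first by rewrite mpolyX0; apply: alg_gen1.
by rewrite mpolyXD; apply: alg_genM => //; apply: S_diag.
Qed.

Lemma initial_alg_minors (S S' : R -> Prop) f u :
    (forall p, S p -> exists2 a, facet a & p = minor a) -> alg_gen S f ->
    (forall a, facet a -> alg_gen S' 'X_[diag a]) -> is_initial lex f u ->
  alg_gen S' 'X_[u].
Proof.
move=> S_minors Sf S'_diag f_u.
have leads_prod p v : facet_prod p v -> leads lex p v.
  by case=> s Bp; apply: rees_prod_leads (rees_prod_minors Bp).
have [p [s Bp] _] := @subduction _ _ lex (@lex_wf _) _ leads_prod facet_prod_cong _ _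
  (alg_minors_lspan S_minors Sf) f_u.
exact: facet_prod_monomial S'_diag Bp.
Qed.

Local Notation t_lex := (t_lex_order (m * n)).
Local Notation t_ := ('X_ord_max : {mpoly K[(m * n).+1]}).

(** The exponent of x^u t^s. *)
Definition t_mon (u : 'X_{1..m * n}) (s : nat) : 'X_{1..(m * n).+1} :=
  (mnmwiden u + U_(ord_max) *+ s)%MM.

Lemma t_mon_max u s : t_mon u s ord_max = s.
Proof. by rewrite mnmDE mnmwiden_ordmax mulmnE mnm1E eqxx mul1n. Qed.

Lemma xpart_t_mon u s : xpart (t_mon u s) = u.
Proof.
apply/mnmP=> i; rewrite mnmE mnmDE mulmnE mnm1E.
rewrite mnmwiden_widen (_ : (_ == _) = false) ?mul0n ?addn0 //.
by rewrite -val_eqE /= gtn_eqF.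
Qed.

Lemma t_lex_mon u v s : t_lex (t_mon u s) (t_mon v s) = lex u v.
Proof. by rewrite /= /t_lex_lt !t_mon_max ltnn eqxx !xpart_t_mon. Qed.

Lemma t_monX u s : mwiden 'X_[u] * t_ ^+ s = 'X_[t_mon u s].
Proof. by rewrite mwidenX mpolyXn -mpolyXD. Qed.

Lemma t_monD u v s s' : t_mon (u + v) (s + s') = (t_mon u s + t_mon v s')%MM.
Proof.
by rewrite /t_mon mnmwidenD; apply/mnmP=> i; rewrite !(mnmDE, mulmnE) mulnDr addnACA.
Qed.

Lemma t_coeff (p : R) s u : (mwiden p * t_ ^+ s)@_(t_mon u s) = p@_u.
Proof. by rewrite /t_mon mpolyXn addmC mcoeffMX mwiden_mnmwiden. Qed.

Lemma t_coeff_neq0 (p : R) s w : (mwiden p * t_ ^+ s)@_w != 0 ->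
  exists2 u, p@_u != 0 & w = t_mon u s.
Proof.
have -> : mwiden p * t_ ^+ s = \sum_(u <- msupp p) p@_u *: 'X_[t_mon u s].
  rewrite {1}[p]mpolyE raddf_sum mulr_suml; apply: eq_bigr => u _.
  by rewrite /= mwidenZ -scalerAl t_monX.
have [/hasP[u u_p /eqP <-] _ | no_u] := boolP (has (fun u => t_mon u s == w) (msupp p)).
  by exists u; rewrite // -mcoeff_msupp.
rewrite raddf_sum big_seq big1 /= ?eqxx // => u u_p.
rewrite mcoeffZ mcoeffX (negPf (_ : t_mon u s != w)) ?mulr0 //.
by apply: contra no_u => eq_w; apply/hasP; exists u.
Qed.

Lemma t_initial (p : R) s u : is_initial lex p u ->
  is_initial t_lex (mwiden p * t_ ^+ s) (t_mon u s).
Proof.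
case=> p_u lt_u; split; first by rewrite mcoeff_msupp t_coeff -mcoeff_msupp.
move=> w; rewrite mcoeff_msupp => /t_coeff_neq0[v p_v ->] ne_vu.
rewrite t_lex_mon; apply: lt_u; first by rewrite mcoeff_msupp.
by apply: contraNneq ne_vu => ->.
Qed.

Lemma t_leads (p : R) s u : leads lex p u -> leads t_lex (mwiden p * t_ ^+ s) (t_mon u s).
Proof.
move=> p_u; have [_ lt_u] := t_initial s (leads_initial p_u); have [p1 _] := p_u.
by split=> [|w]; [rewrite t_coeff | rewrite -mcoeff_msupp; apply: lt_u].
Qed.

Let t_prod (p : {mpoly K[(m * n).+1]}) w :=
  exists s r u, [/\ rees_prod s r u, p = mwiden r * t_ ^+ s & w = t_mon u s].

Lemma t_prod_leads p w : t_prod p w -> leads t_lex p w.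
Proof. by case=> s [r [u [Qr -> ->]]]; apply/t_leads/(rees_prod_leads Qr). Qed.

Lemma t_prod_cong p q w : t_prod p w -> t_prod q w ->
  lspan (below t_lex t_prod w) (p - q).
Proof.
case=> s [r [u [Qr -> ->]]] [s' [r' [u' [Qr' -> eq_w]]]].
have es : s' = s.
  by have := congr1 (fun w : 'X_{1..(m * n).+1} => w ord_max) eq_w; rewrite !t_mon_max.
rewrite {s'}es in Qr' eq_w *.
have eu : u' = u by have := congr1 (@xpart _) eq_w; rewrite !xpart_t_mon.
rewrite {u'}eu in Qr' eq_w *.
rewrite -mulrBl -raddfB /=.
apply: (@lspan_map _ _ _ (fun q => mwiden q * t_ ^+ s)) (rees_prod_cong interv_chain Qr Qr').
- by rewrite mwiden0 mul0r.
- by move=> x y; rewrite mwidenD mulrDl.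
- by move=> c x; rewrite mwidenZ scalerAl.
move=> x [v [Qx lt_v _]]; apply: lspan_mem; exists (t_mon v s); last by rewrite t_lex_mon.
by exists s, x, v.
Qed.

Lemma ideal_minors_lspan (S : R -> Prop) f :
    (forall p, S p -> exists2 a, facet a & p = minor a) -> ideal_gen S f ->
  lspan (fun p => exists u, rees_prod 1 p u) f.
Proof.
move=> S_minors; elim=> [_ /S_minors[a fa ->] | | p q _ IHp _ IHq | p q _ IHq].
- by apply: lspan_mem; exists (diag a); apply: rees_prod_minor.
- by constructor.
- exact: lspanD.
rewrite mulrC; apply: lspan_mulr IHq => q' [u Qq]; rewrite mulrC.
apply: lspan_mulr (lspan_monomials p) => _ [v ->].
by apply: lspan_mem; exists (v + u)%MM; apply: rees_prodM (rees_prodX _ _ _) Qq.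
Qed.

Lemma rees_minors_lspan (S : R -> Prop) f :
    (forall p, S p -> exists2 a, facet a & p = minor a) -> rees (ideal_gen S) f ->
  lspan (fun p => exists w, t_prod p w) f.
Proof.
move=> S_minors; have lspanX g : lspan (fun p => exists w, t_prod p w) (mwiden g).
  apply: (@lspan_map _ _ _ (@mwiden _ _)) (lspan_monomials g).
  - exact: mwiden0.
  - exact: mwidenD.
  - exact: mwidenZ.
  move=> _ [v ->]; apply: lspan_mem; exists (t_mon v 0), 0%N, 'X_[v], v.
  by rewrite expr0 mulr1; split=> //; apply: rees_prodX.
elim=> [p [[g ->] | [g Jg ->]] | c | p q _ IHp _ IHq | p q _ IHp _ IHq].
- exact: lspanX.
- apply: (@lspan_map _ _ _ (fun q => mwiden q * t_)) (ideal_minors_lspan S_minors Jg).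
  + by rewrite mwiden0 mul0r.
  + by move=> x y; rewrite mwidenD mulrDl.
  + by move=> c x; rewrite mwidenZ scalerAl.
  move=> x [v Qx]; apply: lspan_mem; exists (t_mon v 1), 1%N, x, v.
  by rewrite expr1.
- by rewrite -mwidenC; apply: lspanX.
- exact: lspanD.
apply: lspan_mulr IHp => _ [_ [s [r [u [Qr -> _]]]]]; rewrite mulrC.
apply: lspan_mulr IHq => _ [_ [s' [r' [u' [Qr' -> _]]]]].
apply: lspan_mem; exists (t_mon (u' + u) (s' + s)), (s' + s)%N, (r' * r), (u' + u)%MM.
by split=> //; [apply: rees_prodM | rewrite mwidenM exprD mulrACA].
Qed.

Lemma alg_gen_mwiden (S : {mpoly K[(m * n).+1]} -> Prop) f :
  (forall i j, alg_gen S (mwiden (gmx K m n i j))) -> alg_gen S (mwiden f).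
Proof.
move=> S_gmx; rewrite [f]mpolyE raddf_sum /=.
have S0 : alg_gen S 0 by rewrite -mpolyC0; apply: alg_genC.
apply: big_ind => //; first exact: alg_genD.
move=> u _; rewrite mwidenZ; apply: alg_genZ.
rewrite mpolyXE_id rmorph_prod /=; apply: big_ind; first exact: alg_gen1.
  exact: alg_genM.
move=> k _; rewrite rmorphXn /=; apply: alg_genX; case/mxvec_indexP: k => i j.
by have := S_gmx i j; rewrite mxE.
Qed.

(** Stated for an arbitrary set S' of generators, as it serves all the descriptions of
    the initial algebra of the Rees algebra. *)
Lemma initial_rees_minors (S : R -> Prop) (S' : {mpoly K[(m * n).+1]} -> Prop) f w :
    (forall p, S p -> exists2 a, facet a & p = minor a) -> rees (ideal_gen S) f ->
    (forall i j, alg_gen S' (mwiden (gmx K m n i j))) ->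
    (forall a, facet a -> alg_gen S' (mwiden (diag_mon K a) * t_)) ->
    is_initial t_lex f w ->
  alg_gen S' 'X_[w].
Proof.
move=> S_minors Sf S'_gmx S'_diag f_w.
have [_ [s [_ [_ [[alpha [q [v [Bq _ ->]]]] _ ->]]]] _] :=
  @subduction _ _ t_lex (@t_lex_wf _) _ t_prod_leads t_prod_cong _ _
    (rees_minors_lspan S_minors Sf) f_w.
rewrite -[s]add0n t_monD mpolyXD; apply: alg_genM.
  by rewrite -t_monX expr0 mulr1; apply: alg_gen_mwiden.
elim: Bq => [|a s' p' u' fa _ IH].
  by rewrite -t_monX expr0 mulr1; apply: alg_gen_mwiden.
rewrite -[s'.+1]add1n t_monD mpolyXD; apply: alg_genM => //.
by rewrite -t_monX expr1 -diag_monE; apply: S'_diag.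
Qed.

End AlgebraOfMinors.

Local Close Scope ring_scope.

Theorem theorem4p3 (K : fieldType) (m n : nat) (m_gt0 : 0 < m) (le_mn : m <= n)
    (D : {set {set 'I_n}}) (pure_D : pure_complex m D)
    (unit_D : unit_interval m D) :
  [/\ sagbi_basis (t_lex_order (m * n)) (rees (J K m D)) (rees_gens K m D),
      eq_set (initial_algebra (t_lex_order (m * n)) (rees (J K m D)))
             (adjoin_t (facet_mons K m D)),
      eq_set (initial_algebra (t_lex_order (m * n)) (rees (J K m D)))
             (rees (initial_ideal (lex_order (m * n)) (J K m D))),
      sagbi_basis (lex_order (m * n)) (alg_gen (facet_minors K m D))
                  (facet_minors K m D)
    & eq_set (initial_algebra (lex_order (m * n))
                              (alg_gen (facet_minors K m D)))
             (alg_gen (facet_mons K m D))].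
Proof.
have facP := unit_interval_facetP pure_D unit_D.
have chain := @clique_interval_chain m n D.
have gen_minors p : facet_minors K m D p ->
    exists2 a, facet (clique_interval m D) a & p = maxminor K a.
  by case=> a /facP fa ->; exists a.
have minor_initial a : facet (clique_interval m D) a ->
    is_initial (lex_order (m * n)) (maxminor K a) (diag a).
  by case=> inc_a _; apply: leads_initial (minor_leads K inc_a).
have t_minor_initial a : facet (clique_interval m D) a ->
    is_initial (t_lex_order (m * n)) (mwiden (maxminor K a) * 'X_ord_max)%R (t_mon (diag a) 1).
  by move/minor_initial/(t_initial 1); rewrite expr1.
have t_diagE (a : 'I_m -> 'I_n) : (mwiden (diag_mon K a) * 'X_ord_max = 'X_[t_mon (diag a) 1])%R.
  by rewrite -t_monX expr1 diag_monE.
have gmx_initial i j : is_initial (t_lex_order (m * n))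
    (mwiden (gmx K m n i j)) (mnmwiden U_(mxvec_index i j)).
  by rewrite mxE mwidenX; apply/leads_initial/leadsX.
have gmxE i j : mwiden (gmx K m n i j) = 'X_[mnmwiden U_(mxvec_index i j)].
  by rewrite mxE mwidenX.
have rees_mwiden f : rees (J K m D) (mwiden f) by apply: alg_gen_mem; left; exists f.
have rees_minor a : facet (clique_interval m D) a ->
    rees (J K m D) (mwiden (maxminor K a) * 'X_ord_max)%R.
  move=> fa; apply: alg_gen_mem; right; exists (maxminor K a) => //.
  by apply: ideal_gen_mem; exists a => //; apply/facP.
have in_rees f : initial_algebra (t_lex_order (m * n)) (rees (J K m D)) (mwiden f).
  apply: alg_gen_mwiden => i j; apply: alg_gen_mem.
  by exists (mwiden (gmx K m n i j)), (mnmwiden U_(mxvec_index i j)).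
split.
- split=> [p [[i [j ->]] | [a /facP fa ->]] | p]; [exact: rees_mwiden | exact: rees_minor |].
  split; apply: alg_gen_bind => _ [f [w [Af f_w ->]]].
    apply: (initial_rees_minors chain gen_minors Af _ _ f_w) => [i j | a fa].
      apply: alg_gen_mem; exists (mwiden (gmx K m n i j)), (mnmwiden U_(mxvec_index i j)).
      by split=> //; left; exists i, j.
    apply: alg_gen_mem; exists (mwiden (maxminor K a) * 'X_ord_max)%R, (t_mon (diag a) 1).
    by split; [right; exists a => //; apply/facP | apply: t_minor_initial | apply: t_diagE].
  apply: alg_gen_mem; exists f, w; split=> //.
  by case: Af => [[i [j ->]] | [a /facP fa ->]]; [apply: rees_mwiden | apply: rees_minor].
- move=> p; split; apply: alg_gen_bind.
  + move=> _ [f [w [Af f_w ->]]].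
    apply: (initial_rees_minors chain gen_minors Af _ _ f_w) => [i j | a fa].
      by apply: alg_gen_mem; left; exists (gmx K m n i j).
    apply: alg_gen_mem; right; exists (diag_mon K a) => //.
    by exists a => //; apply/facP.
  move=> _ [[f ->] | [_ [a /facP fa ->] ->]]; first exact: in_rees.
  apply: alg_gen_mem; exists (mwiden (maxminor K a) * 'X_ord_max)%R, (t_mon (diag a) 1).
  by split; [apply: rees_minor | apply: t_minor_initial | apply: t_diagE].
- move=> p; split; apply: alg_gen_bind.
  + move=> _ [f [w [Af f_w ->]]].
    apply: (initial_rees_minors chain gen_minors Af _ _ f_w) => [i j | a fa].
      by apply: alg_gen_mem; left; exists (gmx K m n i j).
    apply: alg_gen_mem; right; exists (diag_mon K a) => //.
    apply: ideal_gen_mem; exists (maxminor K a), (diag a); split.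
    * by apply: ideal_gen_mem; exists a => //; apply/facP.
    * exact: minor_initial.
    * exact: diag_monE.
  move=> _ [[f ->] | [f Jf ->]]; first exact: in_rees.
  elim: Jf => [_ [g [u [Jg g_u ->]]] | | g h _ IHg _ IHh | g h _ IHh].
  (* An initial monomial of g in J becomes that of g t in the Rees algebra. *)
  + apply: alg_gen_mem; exists (mwiden g * 'X_ord_max)%R, (t_mon u 1); split.
    * by apply: alg_gen_mem; right; exists g.
    * by have := t_initial 1 g_u; rewrite expr1.
    * by rewrite -t_monX expr1.
  + by rewrite mwiden0 mul0r -mpolyC0; apply: alg_genC.
  + by rewrite mwidenD mulrDl; apply: alg_genD.
  by rewrite mwidenM -mulrA; apply: alg_genM => //; apply: in_rees.
- split=> [p | p]; first exact: alg_gen_mem.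
  split; apply: alg_gen_bind => _ [f [u [Af f_u ->]]].
    apply: (initial_alg_minors m_gt0 chain gen_minors Af _ f_u) => a fa.
    apply: alg_gen_mem; exists (maxminor K a), (diag a).
    by split=> //; [exists a => //; apply/facP | apply: minor_initial].
  by apply: alg_gen_mem; exists f, u; split=> //; apply: alg_gen_mem.
move=> p; split; apply: alg_gen_bind.
  move=> _ [f [u [Af f_u ->]]].
  apply: (initial_alg_minors m_gt0 chain gen_minors Af _ f_u) => a fa.
  by apply: alg_gen_mem; exists a; [apply/facP | rewrite diag_monE].
move=> _ [a /facP fa ->].
apply: alg_gen_mem; exists (maxminor K a), (diag a); split; last exact: diag_monE.
  by apply: alg_gen_mem; exists a => //; apply/facP.
exact: minor_initial.
Qed.
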